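(* Let $M=\{(q_1,q_2)\in(\mathbb{C}^* )^2\mid q_1\neq\frac14\}$ and let $\bigtriangledown^{\omega_0}$ be the flat connection on the tangent sheaf $\Theta_M$ defined in the context from the Landau–Ginzburg model $F=u_1+u_2+q_1\frac{u_2^2}{u_1}+q_2\frac1{u_2}$. The (multivalued) vector fields $$\xi_1=-(1-4q_1)^{1/2}q_1\partial_{q_1}+\Big(\tfrac12(1-4q_1)^{1/2}+\tfrac12\Big)q_2\partial_{q_2},\qquad\xi_2=q_2\partial_{q_2}$$ are $\bigtriangledown^{\omega_0}$-flat, and the functions $\varphi_1$ and $\varphi_2$ defined by $$q_1=\frac{e^{\varphi_1}}{(1+e^{\varphi_1})^2}\quad\text{and}\quad q_2=e^{\varphi_2}(e^{\varphi_1}+1)$$ are flat coordinates, i.e. the vector fields $\partial_{\varphi_1},\partial_{\varphi_2}$ defined by $d\varphi_j(\partial_{\varphi_i})=\delta_{ij}$ are $\bigtriangledown^{\omega_0}$-flat.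
   Context: $U=(\mathbb{C}^* )^2$, $\mathbb{C}[M,\theta]:=\mathbb{C}[q_1,q_2,q_1^{-1},q_2^{-1},(4q_1-1)^{-1},\theta]$, $\tau=\theta^{-1}$. The Brieskorn lattice of $F$ is $G_0=\Omega^2(U)[M,\theta]/(\theta d-dF\wedge)\Omega^1(U)[M,\theta]$, where $\Omega^k(U)[M,\theta]=\Omega^k(U)\otimes\mathbb{C}[M,\theta]$ and $d$ is the differential with respect to $(u_1,u_2)$ only. $G_0[\theta^{-1}]$ carries the flat connection $\nabla$ with $\theta^2\nabla_{\partial_\theta}[\eta]=[F\eta]$, $\theta\nabla_{\partial_{q_i}}[\eta]=-[\frac{\partial F}{\partial q_i}\eta]$ for $\eta\in\Omega^2(U)$. Let $\omega_0=[\frac{du_1}{u_1}\wedge\frac{du_2}{u_2}]$, $\omega_1=-\theta q_2\nabla_{\partial_{q_2}}\omega_0$, $\omega_2=\theta q_2\nabla_{\partial_{q_2}}\theta q_1\nabla_{\partial_{q_1}}\omega_0$, $\omega_3=-\theta q_1\nabla_{\partial_{q_1}}\omega_0$; this is a basis of $G_0$ over $\mathbb{C}[M,\theta]$. In this basis $\nabla=\bigtriangledown+\frac\Phi\theta+(\frac{V_0}\theta+V_\infty)\frac{d\theta}\theta$ where, on $E=G_0/\theta G_0$, $\bigtriangledown$ (the residual connection) is a flat connection, $\Phi:E\to E\otimes\Omega^1_M$ and $V_0,V_\infty$ are $\mathcal{O}_M$-linear. Explicitly, $\bigtriangledown\omega_0=\bigtriangledown\omega_1=\bigtriangledown\omega_2=0$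 and $\bigtriangledown\omega_3=(\omega_1-2\omega_3)\frac{dq_1}{4q_1-1}$. The period map $\varphi_{\omega_0}:\Theta_M\to E$, $\varphi_{\omega_0}(X)=-\Phi_X(\omega_0)$, is injective (it sends $q_1\partial_{q_1}$ to $\omega_3$ and $q_2\partial_{q_2}$ to $\omega_1$), its image is stable under $\bigtriangledown$, and $\bigtriangledown^{\omega_0}$ is the connection on $\Theta_M$ defined by $\varphi_{\omega_0}(\bigtriangledown^{\omega_0}X)=\bigtriangledown\varphi_{\omega_0}(X)$. *)

(* Defs.v *)
From Stdlib Require Import Reals List.
From Coquelicot Require Import Coquelicot.
Import ListNotations.

Open Scope C_scope.

Inductive coord := c1 | c2.

Definition proj (i : coord) (z : C * C) : C :=
  match i with c1 => fst z | c2 => snd z end.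

Definition pderiv (i : coord) (f : C * C -> C) (z : C * C) : C :=
  match i with
  | c1 => C_derive (fun t => f (t, snd z)) (fst z)
  | c2 => C_derive (fun t => f (fst z, t)) (snd z)
  end.

Definition Cexp (z : C) : C :=
  (exp (fst z) * cos (snd z), exp (fst z) * sin (snd z))%R.

(* The ring of functions on [D] generated over the complex numbers by [gens].
   Members are total functions, but only their values on [D] matter. *)
Inductive regular {T : Type} (D : T -> Prop) (gens : list (T -> C)) :
    (T -> C) -> Prop :=
| reg_const (a : C) : regular D gens (fun _ => a)
| reg_gen f : In f gens -> regular D gens f
| reg_add f g : regular D gens f -> regular D gens g ->
    regular D gens (fun x => f x + g x)
| reg_mul f g : regular D gens f -> regular D gens g ->
    regular D gens (fun x => f x * g x)
| reg_ext f g : regular D gens g -> (forall x, D x -> f x = g x) ->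
    regular D gens f.

Definition M (q : C * C) : Prop :=
  fst q <> 0 /\ snd q <> 0 /\ fst q <> / 4.

Definition U (u : C * C) : Prop := fst u <> 0 /\ snd u <> 0.

(* Polynomials in theta are identified with functions of theta <> 0; this
   loses nothing, and theta^-1 is then a function on the same domain. *)
Definition Mth (x : C * C * C) : Prop := let '(q, th) := x in M q /\ th <> 0.

Definition MthU (x : C * C * C * (C * C)) : Prop :=
  let '(q, th, u) := x in M q /\ th <> 0 /\ U u.

Definition gensM : list (C * C -> C) :=
  [fst; snd; (fun q => / fst q); (fun q => / snd q);
   (fun q => / (4 * fst q - 1))].

Definition gensMth : list (C * C * C -> C) :=
  (fun x => snd x) :: map (fun f x => f (fst x)) gensM.

Definition gensMthU : list (C * C * C * (C * C) -> C) :=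
  [(fun x => fst (snd x)); (fun x => snd (snd x));
   (fun x => / fst (snd x)); (fun x => / snd (snd x))]
  ++ map (fun f x => f (fst x)) gensMth.

(* C[M] = C[q1^+-1, q2^+-1, (4 q1 - 1)^-1],  C[M, theta] = C[M][theta], and
   O(U)[M, theta] = C[M, theta][u1^+-1, u2^+-1]. *)
Definition regM : (C * C -> C) -> Prop := regular M gensM.
Definition regMth : (C * C * C -> C) -> Prop := regular Mth gensMth.
Definition regMthU : (C * C * C * (C * C) -> C) -> Prop :=
  regular MthU gensMthU.

Definition F (q u : C * C) : C :=
  fst u + snd u + fst q * (snd u ^ 2 / fst u) + snd q * / snd u.

(* A 1-form is given by its coefficients on du1, du2, and a 2-form by its
   coefficient on du1 /\ du2. *)
Definition oneform := coord -> C * C * C * (C * C) -> C.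
Definition twoform := C * C * C * (C * C) -> C.

(* (theta d - dF /\) on 1-forms, where d only involves u1, u2. *)
Definition twisted_d (al : oneform) : twoform := fun '(q, th, u) =>
  th * (pderiv c1 (fun v => al c2 (q, th, v)) u
        - pderiv c2 (fun v => al c1 (q, th, v)) u)
  - (pderiv c1 (F q) u * al c2 (q, th, u)
     - pderiv c2 (F q) u * al c1 (q, th, u)).

(* Equality of classes in G_0; the elements of G_0 are the classes of the
   2-forms with coefficient in [regMthU]. *)
Definition eqG0 (eta eta' : twoform) : Prop :=
  exists al : oneform, (forall i, regMthU (al i)) /\
    forall x, MthU x -> eta x - eta' x = twisted_d al x.

(* Equality of classes in the localization G_0[theta^-1]. *)
Definition eqG0loc (eta eta' : twoform) : Prop :=
  exists n : nat,
    eqG0 (fun '(q, th, u) => th ^ n * eta (q, th, u))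
         (fun '(q, th, u) => th ^ n * eta' (q, th, u)).

(* The connection on representatives: its values on 2-forms independent of q
   and theta, extended by the Leibniz rule. *)
Definition nabla_q (i : coord) (eta : twoform) : twoform := fun '(q, th, u) =>
  pderiv i (fun p => eta (p, th, u)) q
  - / th * (pderiv i (fun p => F p u) q * eta (q, th, u)).

Definition nabla_th (eta : twoform) : twoform := fun '(q, th, u) =>
  C_derive (fun t => eta (q, t, u)) th + / th ^ 2 * (F q u * eta (q, th, u)).

Definition th_q_nabla (i : coord) (eta : twoform) : twoform :=
  fun '(q, th, u) => th * proj i q * nabla_q i eta (q, th, u).

Definition omega0 : twoform := fun '(_, _, u) => / fst u * / snd u.

(* Indices k > 3 are never used. *)
Definition omega (k : nat) : twoform :=
  match k with
  | 0%nat => omega0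
  | 1%nat => fun x => - th_q_nabla c2 omega0 x
  | 2%nat => th_q_nabla c2 (th_q_nabla c1 omega0)
  | _ => fun x => - th_q_nabla c1 omega0 x
  end.

(* [sum_n a 3] is a 0 + a 1 + a 2 + a 3. *)
Definition lincomb (c : nat -> C * C * C -> C) : twoform := fun '(q, th, u) =>
  sum_n (fun k => c k (q, th) * omega k (q, th, u)) 3.

(* omega_0, ..., omega_3 form a basis of G_0 over C[M, theta]. *)
Definition omega_basis : Prop :=
  (forall k, (k <= 3)%nat -> regMthU (omega k)) /\
  (forall eta, regMthU eta ->
     exists c, (forall k, regMth (c k)) /\ eqG0 eta (lincomb c)) /\
  (forall c, (forall k, regMth (c k)) -> eqG0 (lincomb c) (fun _ => 0) ->
     forall k, (k <= 3)%nat -> forall x, Mth x -> c k x = 0).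

(* Matrices, in the basis omega, of the pieces of
     nabla = res + Phi/theta + (V0/theta + Vinf) dtheta/theta.
   The entry (k, j) is the coefficient on omega_k of the image of omega_j;
   for [res] and [Phi] the first argument i selects the component along
   d/dq_i. *)
Record conn_data := ConnData {
  res : coord -> nat -> nat -> C * C -> C;
  Phi : coord -> nat -> nat -> C * C -> C;
  V0 : nat -> nat -> C * C -> C;
  Vinf : nat -> nat -> C * C -> C }.

Definition is_conn_data (b : conn_data) : Prop :=
  omega_basis /\
  (forall i k j, regM (res b i k j) /\ regM (Phi b i k j) /\
     regM (V0 b k j) /\ regM (Vinf b k j)) /\
  (forall i j, (j <= 3)%nat ->
     eqG0loc (nabla_q i (omega j))
       (lincomb (fun k '(q, th) => res b i k j q + Phi b i k j q / th))) /\
  (forall j, (j <= 3)%nat ->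
     eqG0loc (nabla_th (omega j))
       (lincomb (fun k '(q, th) => (V0 b k j q / th + Vinf b k j q) / th))).

Definition holomorphic (W : C * C -> Prop) (f : C * C -> C) : Prop :=
  forall q : C * C, W q -> ex_filterdiff (K := C_AbsRing) f (locally q).

Definition open_in_M (W : C * C -> Prop) : Prop :=
  open W /\ forall q, W q -> M q.

(* An analytic section of E = G_0/theta G_0, given by its coordinates in the
   O_M-basis of E induced by omega_0, ..., omega_3. *)
Definition sectionE := nat -> C * C -> C.

Definition residual (b : conn_data) (i : coord) (s : sectionE) : sectionE :=
  fun k q => pderiv i (s k) q + sum_n (fun j => res b i k j q * s j q) 3.

(* A vector field, given by its coefficients on d/dq_1, d/dq_2. *)
Definition vfield := coord -> C * C -> C.

(* The period map X |-> - Phi_X(omega_0). *)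
Definition period (b : conn_data) (X : vfield) : sectionE := fun k q =>
  - (X c1 q * Phi b c1 k 0%nat q + X c2 q * Phi b c2 k 0%nat q).

(* A connection on Theta_M, given by its Christoffel symbols: [G i k j] is
   the coefficient on d/dq_k of the derivative of d/dq_j along d/dq_i. *)
Definition christoffel := coord -> coord -> coord -> C * C -> C.

Definition covderiv (G : christoffel) (i : coord) (X : vfield) : vfield :=
  fun k q => pderiv i (X k) q + G i k c1 q * X c1 q + G i k c2 q * X c2 q.

Definition is_nabla_omega0 (b : conn_data) (G : christoffel) : Prop :=
  (forall i k j, holomorphic M (G i k j)) /\
  forall (W : C * C -> Prop) (X : vfield), open_in_M W ->
    (forall k, holomorphic W (X k)) ->
    forall i k q, (k <= 3)%nat -> W q ->
      period b (covderiv G i X) k q = residual b i (period b X) k q.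

Definition flat (G : christoffel) (W : C * C -> Prop) (X : vfield) : Prop :=
  (forall k, holomorphic W (X k)) /\
  forall i k q, W q -> covderiv G i X k q = 0.

(* [s] is a branch on [W] of (1 - 4 q1)^(1/2). *)
Definition sqrt_branch (W : C * C -> Prop) (s : C * C -> C) : Prop :=
  holomorphic W s /\ forall q, W q -> s q ^ 2 = 1 - 4 * fst q.

Definition xi1 (s : C * C -> C) : vfield := fun k q =>
  match k with
  | c1 => - (s q * fst q)
  | c2 => (/ 2 * s q + / 2) * snd q
  end.

Definition xi2 : vfield := fun k q =>
  match k with c1 => 0 | c2 => snd q end.

(* [phi] is a branch on [W] of the pair of multivalued functions. *)
Definition phi_branch (W : C * C -> Prop) (phi : coord -> C * C -> C) : Prop :=
  (forall j, holomorphic W (phi j)) /\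
  forall q, W q ->
    fst q = Cexp (phi c1 q) / (1 + Cexp (phi c1 q)) ^ 2 /\
    snd q = Cexp (phi c2 q) * (Cexp (phi c1 q) + 1).

(* d phi_j (Y_i) = delta_ij on [W]. *)
Definition dual_frame (W : C * C -> Prop) (phi : coord -> C * C -> C)
    (Y : coord -> vfield) : Prop :=
  forall i j q, W q ->
    pderiv c1 (phi j) q * Y i c1 q + pderiv c2 (phi j) q * Y i c2 q
    = match i, j with c1, c1 | c2, c2 => 1 | _, _ => 0 end.

(* Main.v *)
(* Write e(m,n) for u1^m u2^n du1/u1 /\ du2/u2.  In G_0 one has
     theta m e(m,n) = e(m+1,n) - q1 e(m-1,n+2),
     theta n e(m,n) = e(m,n+1) + 2 q1 e(m-1,n+2) - q2 e(m,n-1).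
   The first family expresses every e(m,n) through the columns m = 0 and m = -1,
   and on these two columns the second one becomes an order 4 recurrence in n,
   solvable in both directions because q1, q2 and 1 - 4 q1 are invertible.
   Hence omega_0, ..., omega_3 span G_0; they are independent because the same
   recurrences build four functionals on Laurent polynomials that vanish on all
   relations (the operators theta D_i - D_i F commute, so the second family,
   once true on two columns, propagates to all of them).
   The matrices of nabla are then read off.  In the frame q1 d/dq1, q2 d/dq2 a
   vector field X is flat iff a = X_1/q1 and b = X_2/q2 satisfy
   da = 2 a dq1/(4 q1 - 1) and db = - a dq1/(4 q1 - 1), which xi_1 and xi_2 do;
   finally d/dphi_2 = xi_2 and d/dphi_1 = xi_1 for the branch
   (e^phi_1 - 1)/(e^phi_1 + 1) of (1 - 4 q1)^(1/2). *)

From Stdlib Require Import Reals List Lra Lia ZArith FunctionalExtensionality.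
From Coquelicot Require Import Coquelicot.
Require Import Defs.
Import ListNotations.

Open Scope C_scope.
Set Bullet Behavior "Strict Subproofs".

(** * Complex differentiation *)

(** The theorem concerns every matrix decomposition [b] and every compatible connection [G], so
    exhibiting the matrices does not suffice: freeness of omega_0, ..., omega_3 forces [res] and
    [Phi] of any such [b] to take the computed values on [M], the two being separated by varying
    theta. Flatness for an arbitrary [G] is read through the period map, whose injectivity on [M]
    carries vanishing back to vector fields. Freeness is the delicate half of the basis statement:
    forms are functions compared on their domain, whereas the four functionals are defined on
    coefficients. They are built for one fixed (q, theta), where a regular form becomes a Laurent
    polynomial in u; such a polynomial has zero coefficients if it vanishes on [U], so the
    functionals are well defined. This suffices because an element of C[M, theta] is itself a
    function, zero when all its values are. The same window of four monomials drives both halves: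
    the relations move it up and down among classes for spanning, among values of a functional for
    freeness. *)

Lemma filterdiff_codom_C {U : NormedModule C_AbsRing} (f l : U -> C) D :
  filterdiff (V := C_NormedModule) f D l <->
  filterdiff (V := AbsRing_NormedModule C_AbsRing) f D l.
Proof.
  split; intros [[H1 H2 H3] H];
    (split; [split; [exact H1 | exact H2 | exact H3] | exact H]).
Qed.

(** [C] is a normed module over itself in two ways, with the same norm but different definitions of
    neighbourhoods. On the codomain side only the norm enters, so repacking is enough; on the domain
    side the two filters must be exchanged by [locally_C]. *)
Lemma filterdiff_dom_C {V : NormedModule C_AbsRing} (f l : C -> V) (z : C) :
  filterdiff (U := C_NormedModule) f (locally (T := C_UniformSpace) z) l <->
  filterdiff (U := AbsRing_NormedModule C_AbsRing) f
    (locally (T := AbsRing_UniformSpace C_AbsRing) z) l.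
Proof.
  split; intros [[H1 H2 H3] H];
    (split; [split; [exact H1 | exact H2 | exact H3] |]);
    intros x Hx eps; apply locally_C; refine (H x _ eps);
    intros P HP; apply locally_C; apply Hx; apply locally_C; exact HP.
Qed.

(** The domain stays general so that the calculus rules can be shared by functions of one variable
    ([cder]) and of two ([grad]). *)
Definition cdiff {U : NormedModule C_AbsRing} (f : U -> C) (x : U)
    (l : U -> C) : Prop :=
  filterdiff (V := C_NormedModule) f (locally x) l.

Definition cder (f : C -> C) (z l : C) : Prop :=
  cdiff (U := C_NormedModule) f z (fun h => h * l).

Lemma cdiff_ext {U : NormedModule C_AbsRing} (f g : U -> C) x l :
  locally x (fun y => f y = g y) -> cdiff f x l -> cdiff g x l.
Proof. apply filterdiff_ext_locally. Qed.

Lemma cdiff_lin {U : NormedModule C_AbsRing} (f : U -> C) x (l l' : U -> C) :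
  cdiff f x l -> (forall h, l h = l' h) -> cdiff f x l'.
Proof. intros H E. exact (filterdiff_ext_lin f l l' H E). Qed.

Lemma cdiff_const {U : NormedModule C_AbsRing} (a : C) (x : U) : cdiff (fun _ =>
  a) x (fun _ => 0).
Proof. exact (filterdiff_const (V := C_NormedModule) a). Qed.

Lemma cdiff_plus {U : NormedModule C_AbsRing} (f g : U -> C) x (lf lg : U -> C)
  : cdiff f x lf -> cdiff g x lg ->
  cdiff (fun t => f t + g t) x (fun h => lf h + lg h).
Proof. intros Hf Hg. exact (filterdiff_plus_fct f g lf lg Hf Hg). Qed.

Lemma cdiff_mult {U : NormedModule C_AbsRing} (f g : U -> C) x (lf lg : U -> C)
  : cdiff f x lf -> cdiff g x lg ->
  cdiff (fun t => f t * g t) x (fun h => lf h * g x + f x * lg h).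
Proof.
  intros Hf Hg. apply filterdiff_codom_C.
  apply filterdiff_codom_C in Hf. apply filterdiff_codom_C in Hg.
  exact (filterdiff_mult_fct (K := C_AbsRing) f g x lf lg Cmult_comm Hf Hg).
Qed.

Lemma cdiff_comp {U : NormedModule C_AbsRing} (f : U -> C) (g : C -> C) x
    (lf : U -> C) d : cdiff f x lf -> cder g (f x) d ->
  cdiff (fun t => g (f t)) x (fun h => lf h * d).
Proof.
  intros Hf Hg.
  exact (filterdiff_comp' (V := C_NormedModule) (W := C_NormedModule)
    f g x lf (fun h => h * d) Hf Hg).
Qed.

Lemma cder_id (z : C) : cder (fun t => t) z 1.
Proof.
  apply cdiff_lin with (fun h => h).
  - exact (filterdiff_id (V := C_NormedModule) _).
  - intro h; exact (eq_sym (Cmult_1_r h)).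
Qed.

Lemma cder_unique (f : C -> C) (z l : C) : cder f z l -> C_derive f z = l.
Proof.
  intro H. apply is_C_derive_unique. apply filterdiff_dom_C. exact H.
Qed.

Lemma locally_Cmod (z : C) (d : R) (P : C -> Prop) : (0 < d)%R ->
  (forall y, (Cmod (y - z) < d)%R -> P y) ->
  locally (T := C_UniformSpace) z P.
Proof.
  intros Hd H.
  apply (locally_le_locally_norm (V := C_NormedModule) z P).
  exists (mkposreal d Hd). intros y Hy. apply H. exact Hy.
Qed.

Lemma cder_intro (f : C -> C) (z l : C) :
  (forall eps : posreal, locally (T := C_UniformSpace) z
     (fun y => Cmod (f y - f z - (y - z) * l) <= eps * Cmod (y - z))%R) ->
  cder f z l.
Proof.
  intro H. split.
  - split.
    + intros x y. change ((x + y) * l = x * l + y * l). ring.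
    + intros k x. change (k * x * l = k * (x * l)). ring.
    + exists (Cmod l + 1)%R. split.
      * pose proof (Cmod_ge_0 l); lra.
      * intro x. change (Cmod (x * l) <= (Cmod l + 1) * Cmod x)%R.
        rewrite Cmod_mult. pose proof (Cmod_ge_0 x). nra.
  - intros x Hx eps.
    (* [filterdiff] asks for the estimate at every limit of the filter; limits are unique, so z is
       the only one. *)
    assert (E : z = x) by (apply (is_filter_lim_locally_unique (V :=
      C_NormedModule)); exact Hx).
    rewrite <- E. exact (H eps).
Qed.

Lemma cder_inv (z : C) : z <> 0 -> cder Cinv z (- / (z * z)).
Proof.
  intro Hz. apply cder_intro. intros [eps He]. simpl.
  assert (Hm : (0 < Cmod z)%R) by (apply Cmod_gt_0; exact Hz).
  assert (Hm3 : (0 < Cmod z * Cmod z * Cmod z)%R)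
    by (repeat apply Rmult_lt_0_compat; exact Hm).
  (* The error of the linear approximation is (y - z)^2 / (y z^2). The first bound gives |y| >
     |z|/2, and the second then makes the error at most eps |y - z|. *)
  set (d := Rmin (Cmod z / 2) (eps * (Cmod z * Cmod z * Cmod z) / 2)).
  assert (Hd : (0 < d)%R) by (apply Rmin_pos; nra).
  apply (locally_Cmod z d); [exact Hd |]. intros y Hy.
  assert (H1 : (Cmod (y - z) < Cmod z / 2)%R)
    by (eapply Rlt_le_trans; [exact Hy | apply Rmin_l]).
  assert (H2 : (Cmod (y - z) < eps * (Cmod z * Cmod z * Cmod z) / 2)%R)
    by (eapply Rlt_le_trans; [exact Hy | apply Rmin_r]).
  assert (H3 : (Cmod z <= Cmod y + Cmod (y - z))%R).
  { replace z with (y + - (y - z)) at 1 by ring.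
    rewrite <- (Cmod_opp (y - z)). apply Cmod_triangle. }
  assert (H4 : (Cmod z / 2 < Cmod y)%R) by lra.
  assert (Hy0 : y <> 0) by (apply Cmod_gt_0; lra).
  replace (/ y - / z - (y - z) * - / (z * z))
    with ((y - z) * (y - z) * / (y * z * z)) by (field; auto).
  rewrite !Cmod_mult, Cmod_inv, !Cmod_mult
    by (repeat apply Cmult_neq_0; auto).
  set (e := Cmod (y - z)) in *.
  assert (He0 : (0 <= e)%R) by apply Cmod_ge_0.
  replace (e * e * / (Cmod y * Cmod z * Cmod z))%R
    with (e * / (Cmod y * Cmod z * Cmod z) * e)%R by ring.
  apply Rmult_le_compat_r; [exact He0 |].
  assert (Hp : (0 < Cmod y * Cmod z * Cmod z)%R)
    by (repeat apply Rmult_lt_0_compat; lra).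
  apply Rmult_le_reg_r with (1 := Hp).
  rewrite Rmult_assoc, Rinv_l by lra.
  assert (0 < Cmod z * Cmod z)%R by nra.
  nra.
Qed.

Notation C2_space := (prod_UniformSpace C_UniformSpace C_UniformSpace).
Notation CC :=
  (prod_NormedModule C_AbsRing C_NormedModule C_NormedModule).

Definition grad (f : C * C -> C) (q : C * C) (a b : C) : Prop :=
  cdiff (U := CC)
    f q (fun h => fst h * a + snd h * b).

Lemma grad_ext (f g : C * C -> C) q a b :
  locally (T := C2_space) q
    (fun p => f p = g p) -> grad f q a b -> grad g q a b.
Proof. exact (cdiff_ext (U := CC) f g q _). Qed.

Lemma grad_eq f q a b a' b' :
  grad f q a b -> a = a' -> b = b' -> grad f q a' b'.
Proof. intros H <- <-. exact H. Qed.

Lemma grad_const (c : C) q : grad (fun _ => c) q 0 0.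
Proof.
  eapply cdiff_lin; [apply cdiff_const |]. intro h; simpl; ring.
Qed.

Lemma grad_fst q : grad fst q 1 0.
Proof.
  eapply cdiff_lin.
  - apply (filterdiff_linear (V := C_NormedModule)). apply is_linear_fst.
  - intro h; simpl. ring.
Qed.

Lemma grad_snd q : grad snd q 0 1.
Proof.
  eapply cdiff_lin.
  - apply (filterdiff_linear (V := C_NormedModule)). apply is_linear_snd.
  - intro h; simpl. ring.
Qed.

Lemma grad_plus (f g : C * C -> C) q a b a' b' : grad f q a b -> grad g q a' b'
  ->
  grad (fun p => f p + g p) q (a + a') (b + b').
Proof.
  intros H H'. eapply cdiff_lin; [exact (cdiff_plus _ _ _ _ _ H H') |].
  intro h; simpl; ring.
Qed.

Lemma grad_mult (f g : C * C -> C) q a b a' b' : grad f q a b -> grad g q a' b'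
  ->
  grad (fun p => f p * g p) q (a * g q + f q * a') (b * g q + f q * b').
Proof.
  intros H H'. eapply cdiff_lin; [exact (cdiff_mult _ _ _ _ _ H H') |].
  intro h; simpl; ring.
Qed.

Lemma grad_comp (f : C * C -> C) (g : C -> C) q a b d : grad f q a b -> cder g
  (f q) d ->
  grad (fun p => g (f p)) q (a * d) (b * d).
Proof.
  intros H H'. eapply cdiff_lin; [exact (cdiff_comp _ _ _ _ _ H H') |].
  intro h; simpl; ring.
Qed.

Lemma grad_opp (f : C * C -> C) q a b : grad f q a b -> grad (fun p => - f p) q
  (- a) (- b).
Proof.
  intro H. eapply cdiff_lin; [exact (filterdiff_opp_fct f _ H) |].
  intro h; simpl; unfold opp; simpl; ring.
Qed.

Lemma grad_inv (f : C * C -> C) q a b : f q <> 0 -> grad f q a b ->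
  grad (fun p => / f p) q (- a / (f q * f q)) (- b / (f q * f q)).
Proof.
  intros Hf H.
  eapply grad_eq; [exact (grad_comp _ _ _ _ _ _ H (cder_inv _ Hf)) | |];
  field; exact Hf.
Qed.

Lemma cdiff_slice (f : C * C -> C) (q : C * C) (g1 g2 : C -> C) (t l1 l2 : C)
    a b : (g1 t, g2 t) = q -> cder g1 t l1 -> cder g2 t l2 -> grad f q a b ->
  cder (fun s => f (g1 s, g2 s)) t (l1 * a + l2 * b).
Proof.
  intros <- H1 H2 H. eapply cdiff_lin.
  - apply (filterdiff_comp'_2 (T := C_NormedModule) (U := C_NormedModule)
      (V := C_NormedModule) (W := C_NormedModule) g1 g2 (fun x y => f (x, y)) t
      (fun h => h * l1) (fun h => h * l2) (fun x y => x * a + y * b) H1 H2).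
    eapply filterdiff_ext; [| exact H]. intros [x y]. reflexivity.
  - intro h. cbv beta. ring.
Qed.

(** [pderiv] is a one-variable derivative along a coordinate line; restricting the total derivative
    to that line computes it. *)
Lemma grad_pderiv f q a b : grad f q a b ->
  pderiv c1 f q = a /\ pderiv c2 f q = b.
Proof.
  intro H. destruct q as [x y]. split; apply cder_unique; simpl.
  - eapply cdiff_lin.
    + exact (cdiff_slice f (x, y) (fun t => t) (fun _ => y) x 1 0 a b eq_refl
        (cder_id x) (cdiff_lin _ _ _ (fun h => h * 0) (cdiff_const y _) (fun h
          => eq_sym (Cmult_0_r h))) H).
    + intro h; simpl; ring.
  - eapply cdiff_lin.
    + exact (cdiff_slice f (x, y) (fun _ => x) (fun t => t) y 0 1 a b eq_refl
        (cdiff_lin _ _ _ (fun h => h * 0) (cdiff_const x _) (fun h => eq_sym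
          (Cmult_0_r h))) (cder_id y) H).
    + intro h; simpl; ring.
Qed.

(** A linear form on C^2 is determined by its values on the two basis vectors, so mere
    differentiability, as in [holomorphic], already provides the explicit gradient. *)
Lemma grad_ex f q :
  ex_filterdiff (K := C_AbsRing)
    (U := CC)
    (V := C_NormedModule) f (locally q) <->
  grad f q (pderiv c1 f q) (pderiv c2 f q).
Proof.
  split.
  - intros [l Hl].
    set (e1 := (RtoC 1, RtoC 0) : CC). set (e2 := (RtoC 0, RtoC 1) : CC).
    assert (H : grad f q (l e1) (l e2)).
    { eapply cdiff_lin; [exact Hl |]. intros [h k]. simpl.
      destruct Hl as [[Hp Hs _] _].
      change (l (h, k) = plus (scal h (l e1)) (scal k (l e2))).
      rewrite <- Hs, <- Hs, <- Hp. f_equal.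
      assert (E1 : forall x y : C, x = x * 1 + y * 0) by (intros; ring).
      assert (E2 : forall x y : C, y = x * 0 + y * 1) by (intros; ring).
      exact (f_equal2 pair (E1 h k) (E2 h k)). }
    destruct (grad_pderiv _ _ _ _ H) as [-> ->]. exact H.
  - intro H. eexists. exact H.
Qed.

(** * Exponential and local logarithms *)

Lemma Cmod_le_abs (a b : R) : (Cmod (a, b) <= Rabs a + Rabs b)%R.
Proof.
  unfold Cmod; simpl.
  pose proof (Rabs_pos a). pose proof (Rabs_pos b).
  apply Rsqr_incr_0_var; [| lra].
  rewrite Rsqr_sqrt by nra.
  assert (Ha := Rsqr_abs a). assert (Hb := Rsqr_abs b).
  unfold Rsqr in *. nra.
Qed.

(** The Cauchy-Riemann equations: the real differentials of u and v are the two components of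
    multiplication by a + ib. Each component is approximated within eps/2, since the modulus is at
    most the sum of the absolute values. *)
Lemma cder_CR (u v : R -> R -> R) (z : C) (a b : R) :
  filterdiff (fun p : R * R => u (fst p) (snd p)) (locally z)
    (fun h : R * R => plus (scal (fst h) a) (scal (snd h) (- b)%R)) ->
  filterdiff (fun p : R * R => v (fst p) (snd p)) (locally z)
    (fun h : R * R => plus (scal (fst h) b) (scal (snd h) a)) ->
  cder (fun p => (u (fst p) (snd p), v (fst p) (snd p))) z (a, b).
Proof.
  intros [_ Hu] [_ Hv]. apply cder_intro. intros [eps He]. simpl.
  assert (He2 : (0 < eps / 2)%R) by lra.
  assert (L : is_filter_lim (locally (T := C_UniformSpace) z) z) by (intros P
    HP; exact HP).
  generalize (filter_and _ _ (Hu z L (mkposreal _ He2)) (Hv z L (mkposreal _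
    He2))).
  apply filter_imp. intros [y1 y2] [H1 H2]. destruct z as [z1 z2].
  simpl in H1, H2.
  unfold norm, minus, plus, opp, scal in H1, H2; simpl in H1, H2.
  unfold prod_norm, prod_plus, prod_opp, norm, plus, opp, mult in H1, H2;
    simpl in H1, H2.
  unfold mult, abs in H1, H2; simpl in H1, H2.
  replace (Cmod ((y1, y2) - (z1, z2))) with
   (sqrt (Rabs (y1 + - z1) * (Rabs (y1 + - z1) * 1) +
            Rabs (y2 + - z2) * (Rabs (y2 + - z2) * 1)))%R.
  2:{ unfold Cmod; simpl. f_equal.
      assert (Ha := Rsqr_abs (y1 + - z1)). assert (Hb := Rsqr_abs (y2 + - z2)).
      unfold Rsqr in *. lra. }
  eapply Rle_trans; [apply Cmod_le_abs |]. simpl.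
  match type of H1 with (Rabs ?A <= _)%R => match type of H2 with (Rabs ?B <=
    _)%R =>
    match goal with |- (Rabs ?A' + Rabs ?B' <= _)%R =>
    replace A' with A by ring; replace B' with B by ring end end end.
  lra.
Qed.

Lemma cder_Cexp (z : C) : cder Cexp z (Cexp z).
Proof.
  apply (cder_CR (fun x y => (exp x * cos y)%R) (fun x y => (exp x * sin y)%R)).
  - destruct z as [x y].
    apply (is_derive_filterdiff (fun x y => (exp x * cos y)%R) x y
      (fun x y => (exp x * cos y)%R) (- (exp x * sin y))%R).
    + apply filter_forall. intros [s t]. simpl. auto_derive; [easy | ring].
    + auto_derive; [easy | ring].
    + apply (continuous_mult (K := R_AbsRing) (fun u : R * R => exp (fst u))
        (fun u : R * R => cos (snd u))).
      * apply (continuous_comp fst exp); [apply continuous_fst |].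
        apply (ex_derive_continuous (K := R_AbsRing) (V := R_NormedModule)).
        auto_derive. easy.
      * apply (continuous_comp snd cos); [apply continuous_snd |].
        apply (ex_derive_continuous (K := R_AbsRing) (V := R_NormedModule)).
        auto_derive. easy.
  - destruct z as [x y].
    apply (is_derive_filterdiff (fun x y => (exp x * sin y)%R) x y
      (fun x y => (exp x * sin y)%R) ((exp x * cos y))%R).
    + apply filter_forall. intros [s t]. simpl. auto_derive; [easy | ring].
    + auto_derive; [easy | ring].
    + apply (continuous_mult (K := R_AbsRing) (fun u : R * R => exp (fst u))
        (fun u : R * R => sin (snd u))).
      * apply (continuous_comp fst exp); [apply continuous_fst |].
        apply (ex_derive_continuous (K := R_AbsRing) (V := R_NormedModule)).
        auto_derive. easy.
      * apply (continuous_comp snd sin); [apply continuous_snd |].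
        apply (ex_derive_continuous (K := R_AbsRing) (V := R_NormedModule)).
        auto_derive. easy.
Qed.

Lemma Cexp_plus (z w : C) : Cexp (z + w) = Cexp z * Cexp w.
Proof.
  unfold Cexp; simpl. rewrite exp_plus, cos_plus, sin_plus.
  apply injective_projections; simpl; ring.
Qed.

(* Only meaningful on the right half-plane, where it is the principal branch. *)
Definition Clog (z : C) : C :=
  (ln (fst z * fst z + snd z * snd z) / 2, atan (snd z / fst z))%R.

Lemma Cexp_Clog (z : C) : (0 < fst z)%R -> Cexp (Clog z) = z.
Proof.
  destruct z as [x y]. simpl. intro Hx. unfold Cexp, Clog. simpl.
  rewrite cos_atan, sin_atan.
  assert (Hn : (0 < x * x + y * y)%R) by nra.
  assert (E : exp (ln (x * x + y * y) / 2) = sqrt (x * x + y * y)).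
  { replace (ln (x * x + y * y) / 2)%R with (/ 2 * ln (x * x + y * y))%R by
      field.
    exact (Rpower_sqrt _ Hn). }
  rewrite E.
  replace (1 + (y / x)²)%R with ((x * x + y * y) * / (x * x))%R by (unfold Rsqr;
    field; lra).
  rewrite sqrt_mult_alt by lra. rewrite sqrt_inv, sqrt_square by lra.
  assert (0 < sqrt (x * x + y * y))%R by (apply sqrt_lt_R0; exact Hn).
  apply injective_projections; simpl; field; lra.
Qed.

Lemma cder_Clog (z : C) : (0 < fst z)%R -> cder Clog z (/ z).
Proof.
  intro Hz. destruct z as [x y]. simpl in Hz.
  assert (Hn : (0 < x * x + y * y)%R) by nra.
  assert (Hloc : locally (T := C_UniformSpace) (x, y) (fun p => 0 < fst p)%R).
  { apply (locally_Cmod (x, y) x); [exact Hz |]. intros [s t] H. simpl.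
    pose proof (Rmax_Cmod ((s, t) - (x, y))) as H'. simpl in H'.
    pose proof (Rmax_l (Rabs (s + - x)) (Rabs (t + - y))).
    assert (Rabs (s + - x) < x)%R by lra.
    apply Rabs_def2 in H1. lra. }
  assert (Hc : forall f : R * R -> R, (forall p : R * R,
    0 < fst p -> (f p = (fst p * fst p + snd p * snd p)))%R ->
     continuous f (x, y)).
  { intros f Hf. eapply continuous_ext_loc.
    - eapply filter_imp; [| exact Hloc]. intros p Hp. symmetry. apply Hf.
      exact Hp.
    - apply (continuous_plus (K := R_AbsRing) (V := R_NormedModule) (fun p : R *
        R => (fst p * fst p)%R) (fun p : R * R => (snd p * snd p)%R));
      apply (continuous_mult (K := R_AbsRing));
      first [apply continuous_fst | apply continuous_snd]. }
  assert (Hi : continuous (fun p : R * R => / (fst p * fst p + snd p * snd p))%R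
    (x, y)).
  { apply (continuous_comp (fun p : R * R => (fst p * fst p + snd p * snd p)%R)
      Rinv).
    - apply Hc. reflexivity.
    - apply (ex_derive_continuous (K := R_AbsRing) (V := R_NormedModule)).
      simpl.
      auto_derive. lra. }
  replace (/ (x, y)) with
    ((x / (x * x + y * y), - y / (x * x + y * y))%R : C).
  2:{ unfold Cinv; simpl. apply injective_projections; simpl; f_equal; f_equal;
    ring. }
  apply (cder_CR (fun s t => (ln (s * s + t * t) / 2)%R) (fun s t => atan (t /
    s))).
  - apply (is_derive_filterdiff (fun s t => (ln (s * s + t * t) / 2)%R) x y
      (fun s t => (s * / (s * s + t * t))%R) (- (- y / (x * x + y * y)))%R).
    + eapply filter_imp; [| exact Hloc]. intros [s t] H. simpl in *.
      auto_derive; [nra | field; nra].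
    + auto_derive; [lra | field; lra].
    + apply (continuous_mult (K := R_AbsRing) fst (fun p : R * R => / (fst p *
        fst p + snd p * snd p))%R);
        [apply continuous_fst | exact Hi].
  - apply (is_derive_filterdiff (fun s t => atan (t / s)) x y
      (fun s t => (- t * / (s * s + t * t))%R) (x / (x * x + y * y))%R).
    + eapply filter_imp; [| exact Hloc]. intros [s t] H. simpl in *.
      auto_derive; [lra |]. field. split; nra.
    + auto_derive; [lra |]. field. split; nra.
    + apply (continuous_mult (K := R_AbsRing) (fun p : R * R => - snd p)%R (fun
        p : R * R => / (fst p * fst p + snd p * snd p))%R);
        [| exact Hi].
      apply (continuous_opp (K := R_AbsRing) (V := R_NormedModule)).
      apply continuous_snd.
Qed.

(** The right half-plane and its rotations by -1, i and -i cover the nonzero numbers, and these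
    three units are exponentials. If z/c lies in the right half-plane and e^w = c, then
    [Clog (z / c) + w] is a logarithm of z. *)
Lemma Cexp_surj (z : C) : z <> 0 -> exists w : C, Cexp w = z.
Proof.
  intro Hz.
  assert (Hmul : forall c : C, c <> RtoC 0 -> (exists w : C,
    Cexp w = c) -> (0 < fst (z / c)%C)%R ->
    exists w : C, Cexp w = z).
  { intros c Hc [w Hw] H. exists (Clog (z / c) + w).
    rewrite Cexp_plus, Cexp_Clog, Hw by exact H. field. exact Hc. }
  assert (Hpos : forall c : C, (0 < fst c)%R -> exists w : C, Cexp w = c).
  { intros c Hc. exists (Clog c). apply Cexp_Clog. exact Hc. }
  assert (Hpi : exists w : C, Cexp w = - (1)).
  { exists (0%R, PI). unfold Cexp; simpl. rewrite exp_0, cos_PI, sin_PI.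
    apply injective_projections; simpl; ring. }
  assert (Hi : exists w : C, Cexp w = Ci).
  { exists (0%R, (PI / 2)%R). unfold Cexp; simpl.
    rewrite exp_0, cos_PI2, sin_PI2.
    apply injective_projections; simpl; ring. }
  assert (Hmi : exists w : C, Cexp w = - Ci).
  { exists (0%R, (- (PI / 2))%R). unfold Cexp; simpl.
    rewrite exp_0, cos_neg, sin_neg, cos_PI2, sin_PI2.
    apply injective_projections; simpl; ring. }
  assert (Ci0 : Ci <> 0) by (intro E; apply (f_equal snd) in E; simpl in E;
    lra).
  assert (Cm0 : - Ci <> 0) by (intro E; apply (f_equal snd) in E; simpl in E;
    lra).
  assert (C10 : - (1) <> 0) by (intro E; apply (f_equal fst) in E; simpl in E;
    lra).
  destruct (Rtotal_order (fst z) 0) as [H | [H | H]].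
  - apply (Hmul (- (1)) C10 Hpi). simpl. field_simplify; lra.
  - destruct (Rtotal_order (snd z) 0) as [H' | [H' | H']].
    + apply (Hmul (- Ci) Cm0 Hmi). simpl. field_simplify; lra.
    + exfalso. apply Hz. apply injective_projections; assumption.
    + apply (Hmul Ci Ci0 Hi). simpl. field_simplify; lra.
  - apply Hpos. exact H.
Qed.

(** * Holomorphy at a point and existence of the branches *)

Definition hol_at (f : C * C -> C) (q : C * C) : Prop :=
  exists a b, grad f q a b.

Lemma holomorphic_iff W f : holomorphic W f <-> forall q, W q -> hol_at f q.
Proof.
  split; intros H q Hq.
  - eexists. eexists. apply grad_ex. exact (H q Hq).
  - destruct (H q Hq) as [a [b Hg]]. eexists. exact Hg.
Qed.

Lemma hol_grad f q : hol_at f q -> grad f q (pderiv c1 f q) (pderiv c2 f q).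
Proof. intros [a [b H]]. destruct (grad_pderiv _ _ _ _ H) as [-> ->]. exact H.
Qed.

Lemma hol_continuous (f : C * C -> C) q : hol_at f q ->
  filterlim f (locally (T := C2_space) q)
    (locally (T := C_UniformSpace) (f q)).
Proof.
  intros [a [b H]].
  apply (filterdiff_continuous (U := CC) (V := C_NormedModule) f q).
  eexists. exact H.
Qed.

Lemma hol_const c q : hol_at (fun _ => c) q.
Proof. do 2 eexists; apply grad_const. Qed.

Lemma hol_fst q : hol_at fst q.
Proof. do 2 eexists; apply grad_fst. Qed.

Lemma hol_snd q : hol_at snd q.
Proof. do 2 eexists; apply grad_snd. Qed.

Lemma hol_plus (f g : C * C -> C) q : hol_at f q -> hol_at g q -> hol_at (fun p
  => f p + g p) q.
Proof.
  intros [a [b H]] [a' [b' H']]. do 2 eexists.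
  exact (grad_plus _ _ _ _ _ _ _ H H').
Qed.

Lemma hol_mult (f g : C * C -> C) q : hol_at f q -> hol_at g q -> hol_at (fun p
  => f p * g p) q.
Proof.
  intros [a [b H]] [a' [b' H']]. do 2 eexists.
  exact (grad_mult _ _ _ _ _ _ _ H H').
Qed.

Lemma hol_opp (f : C * C -> C) q : hol_at f q -> hol_at (fun p => - f p) q.
Proof. intros [a [b H]]. do 2 eexists. exact (grad_opp _ _ _ _ H). Qed.

Lemma hol_inv (f : C * C -> C) q : f q <> 0 -> hol_at f q -> hol_at (fun p => /
  f p) q.
Proof. intros Hf [a [b H]]. do 2 eexists. exact (grad_inv _ _ _ _ Hf H). Qed.

Lemma hol_comp (f : C * C -> C) (g : C -> C) q d :
  hol_at f q -> cder g (f q) d -> hol_at (fun p => g (f p)) q.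
Proof. intros [a [b H]] Hg. do 2 eexists. exact (grad_comp _ _ _ _ _ _ H Hg).
Qed.

Lemma hol_ext (f g : C * C -> C) q :
  locally (T := C2_space) q
    (fun p => f p = g p) -> hol_at f q -> hol_at g q.
Proof. intros E [a [b H]]. do 2 eexists. exact (grad_ext _ _ _ _ _ E H). Qed.

Lemma pderiv_ext (f g : C * C -> C) i q :
  locally (T := C2_space) q
    (fun p => f p = g p) -> hol_at f q -> pderiv i g q = pderiv i f q.
Proof.
  intros E H. apply hol_grad in H.
  destruct (grad_pderiv _ _ _ _ (grad_ext _ _ _ _ _ E H)).
  destruct i; assumption.
Qed.

(** Follows the syntax of the function; nonvanishing of denominators is left as a goal when no
    hypothesis states it. *)
Ltac hol_tac :=
  first [assumption | lazymatch goal with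
  | |- hol_at (fun p => @?f p + @?g p) _ => apply (hol_plus f g); hol_tac
  | |- hol_at (fun p => @?f p - @?g p) _ =>
      apply (hol_plus f (fun p => - g p)); hol_tac
  | |- hol_at (fun p => @?f p * @?g p) _ => apply (hol_mult f g); hol_tac
  | |- hol_at (fun p => @?f p / @?g p) _ =>
      apply (hol_mult f (fun p => / g p)); hol_tac
  | |- hol_at (fun p => - @?f p) _ => apply (hol_opp f); hol_tac
  | |- hol_at (fun p => / @?f p) _ => apply (hol_inv f);
    [try assumption | hol_tac]
  | |- hol_at (fun p => fst p) _ => apply hol_fst
  | |- hol_at (fun p => snd p) _ => apply hol_snd
  | |- hol_at _ _ => apply hol_const
  | |- _ => idtac
  end].

Lemma hol_half_plane (f : C * C -> C) q : hol_at f q -> f q <> 0 ->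
  locally (T := C2_space) q
    (fun p => 0 < fst (f p / f q)%C)%R.
Proof.
  intros Hf H0.
  assert (Hg : hol_at (fun p => f p / f q) q) by (hol_tac).
  assert (Hc := hol_continuous _ q Hg).
  apply (Hc (fun z : C => (0 < fst z)%R)).
  replace (f q / f q) with (RtoC 1) by (field; exact H0).
  apply (locally_Cmod 1 1); [lra |]. intros [x y] H.
  pose proof (Rmax_Cmod ((x, y) - 1)) as H'. simpl in *.
  pose proof (Rmax_l (Rabs (x + - (1))) (Rabs (y + - 0))).
  assert (H2 : (Rabs (x + - (1)) < 1)%R) by lra.
  apply Rabs_def2 in H2. lra.
Qed.

Lemma locally_neq0 (f : C * C -> C) q : hol_at f q -> f q <> 0 ->
  locally (T := C2_space) q
    (fun p => f p <> 0).
Proof.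
  intros Hf H0. eapply filter_imp; [| exact (hol_half_plane f q Hf H0)].
  intros p H E. cbv beta in H. rewrite E in H. unfold Cdiv in H.
  rewrite Cmult_0_l in H.
  simpl in H. lra.
Qed.

Lemma four_neq0 : RtoC 4 <> 0.
Proof. intro E. apply (f_equal fst) in E. simpl in E. lra. Qed.

Lemma M_disc (q : C * C) : M q -> 4 * fst q - 1 <> 0.
Proof.
  intros (_ & _ & H) E. apply H.
  replace (fst q) with ((4 * fst q - 1 + 1) / 4) by (field; apply four_neq0).
  rewrite E. field.
Qed.

Lemma open_M : open (T := C2_space) M.
Proof.
  intros q Hq. assert (Hq' := Hq). destruct Hq' as (H1 & H2 & H3).
  apply filter_and; [| apply filter_and].
  - apply locally_neq0; [apply hol_fst | exact H1].
  - apply locally_neq0; [apply hol_snd | exact H2].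
  - eapply filter_imp; [| apply (locally_neq0 (fun p => 4 * fst p - 1));
      [hol_tac | apply M_disc; exact Hq]].
    simpl. intros p Hp E. apply Hp. rewrite E. field.
Qed.

(** Division by f(q) moves the values near q close to 1. Where the quotient stays in the right
    half-plane, its principal logarithm plus a fixed logarithm of f(q) is a holomorphic logarithm of
    f. *)
Lemma local_log (W : C * C -> Prop) (f : C * C -> C) q :
  open_in_M W -> W q -> holomorphic W f -> f q <> 0 ->
  exists W' g, open_in_M W' /\ W' q /\ (forall p, W' p -> W p) /\
    holomorphic W' g /\ forall p, W' p -> Cexp (g p) = f p.
Proof.
  intros [Wo WM] Wq Hf H0.
  assert (Hf' := proj1 (holomorphic_iff _ _) Hf).
  destruct (Cexp_surj _ H0) as [w Hw].
  exists (fun p => W p /\ (0 < fst (f p / f q)%C)%R),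
    (fun p => Clog (f p / f q) + w).
  assert (Hh : forall p, W p -> hol_at (fun p => f p / f q) p).
  { intros p Hp. specialize (Hf' p Hp). hol_tac. }
  split; [split | split; [| split; [| split]]].
  - intros p [Hp Hp']. apply filter_and; [exact (Wo p Hp) |].
    assert (Hc := hol_continuous _ p (Hh p Hp)).
    apply (Hc (fun z : C => (0 < fst z)%R)).
    apply (locally_Cmod _ (fst (f p / f q)) _ Hp'). intros z Hz.
    pose proof (Rmax_Cmod (z - f p / f q)) as H'.
    pose proof (Rmax_l (Rabs (fst (z - f p / f q))) (Rabs (snd (z - f p / f
      q)))).
    assert (H2 : (Rabs (fst (z - f p / f q)%C) < fst (f p / f q)%C)%R) by lra.
    apply Rabs_def2 in H2. unfold Cminus in H2.
    change (fst (z + - (f p / f q))%C) with (fst z + - fst (f p / f q)%C)%R in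
      H2. lra.
  - intros p [Hp _]. exact (WM p Hp).
  - split; [exact Wq |]. replace (f q / f q) with (RtoC 1) by (field; exact H0).
    simpl; lra.
  - intros p Hp. apply Hp.
  - apply holomorphic_iff. intros p [Hp Hp'].
    apply hol_plus; [| apply hol_const].
    eapply (hol_comp (fun p => f p / f q) Clog);
      [exact (Hh p Hp) | apply cder_Clog; exact Hp'].
  - intros p [Hp Hp']. rewrite Cexp_plus, Cexp_Clog, Hw by exact Hp'. field.
    exact H0.
Qed.

Lemma two_neq0 : RtoC 2 <> 0.
Proof. intro E. apply (f_equal fst) in E. simpl in E. lra. Qed.

(** From (1 - s)(1 + s) = 4 q1 and s^2 = 1 - 4 q1, these inequalities express q1 <> 0 and q1 <>
    1/4. *)
Lemma sqrt_branch_neq (W : C * C -> Prop) s q : open_in_M W -> sqrt_branch W s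
  -> W q ->
  1 - s q <> 0 /\ 1 + s q <> 0 /\ s q <> 0.
Proof.
  intros [_ WM] [_ Hs] Wq. specialize (Hs q Wq). specialize (WM q Wq).
  assert (E : 4 * fst q = (1 - s q) * (1 + s q)).
  { replace (4 * fst q) with (1 - (1 - 4 * fst q)) by ring. rewrite <- Hs. simpl.
    ring. }
  assert (H4 : 4 * fst q <> 0).
  { apply Cmult_neq_0; [apply four_neq0 | apply WM]. }
  split; [| split]; intro H.
  - apply H4. rewrite E, H. ring.
  - apply H4. rewrite E, H. ring.
  - apply (M_disc q WM). rewrite E, H. ring.
Qed.

Lemma C1_neq0 : RtoC 1 <> 0.
Proof. intro E. apply (f_equal fst) in E. simpl in E. lra. Qed.

Lemma Cinv_neq0 (z : C) : z <> 0 -> / z <> 0.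
Proof.
  intros Hz E. apply C1_neq0. rewrite <- (Cinv_l z Hz), E. ring.
Qed.

(** For E = e^phi_1 the equation q1 = E / (1 + E)^2 is quadratic, with root E = (1 - s)/(1 + s)
    where s^2 = 1 - 4 q1. Then 1 + E = 2/(1 + s), whence e^phi_2 = q2 (1 + s)/2. Three local
    logarithms are taken in turn, for s, phi_1 and phi_2, each on a smaller neighbourhood of q. *)
Lemma branches_exist (q : C * C) : M q ->
  exists (W : C * C -> Prop) (s : C * C -> C) (phi : coord -> C * C -> C),
    open_in_M W /\ W q /\ sqrt_branch W s /\ phi_branch W phi.
Proof.
  intro Hq.
  assert (HM : open_in_M M) by (split; [apply open_M | auto]).
  destruct (local_log M (fun p => 1 - 4 * fst p) q HM Hq) as (W1 & l & Ho1 & Hq1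
    & _ & Hl & El).
  { apply holomorphic_iff. intros p _. hol_tac. }
  { intro E. apply (M_disc q Hq).
    replace (4 * fst q - 1) with (- (1 - 4 * fst q)) by ring.
    rewrite E. ring. }
  set (s := fun p => Cexp (l p * / 2)).
  assert (Hs : sqrt_branch W1 s).
  { split.
    - apply holomorphic_iff. intros p Hp. unfold s.
      eapply (hol_comp (fun p => l p * / 2)); [| apply cder_Cexp].
      assert (hol_at l p) by (apply (proj1 (holomorphic_iff _ _) Hl p Hp)).
      hol_tac. apply two_neq0.
    - intros p Hp. unfold s. simpl.
      rewrite Cmult_1_r, <- Cexp_plus, <- (El p Hp).
      f_equal. field. }
  assert (Hsh : forall p, W1 p -> hol_at s p)
    by exact (proj1 (holomorphic_iff _ _) (proj1 Hs)).
  assert (Hn : forall p, W1 p -> 1 - s p <> 0 /\ 1 + s p <> 0 /\ s p <> 0)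
    by (intros p Hp; exact (sqrt_branch_neq W1 s p Ho1 Hs Hp)).
  destruct (local_log W1 (fun p => (1 - s p) / (1 + s p)) q Ho1 Hq1)
    as (W2 & f1 & Ho2 & Hq2 & H21 & Hf1 & Ef1).
  { apply holomorphic_iff. intros p Hp. destruct (Hn p Hp) as (? & ? & ?).
    specialize (Hsh p Hp). hol_tac. }
  { destruct (Hn q Hq1) as (? & ? & ?). unfold Cdiv.
    apply Cmult_neq_0; [assumption |].
    apply Cinv_neq0. assumption. }
  assert (Hn2 : forall p, W2 p -> 1 - s p <> 0 /\ 1 + s p <> 0 /\ s p <> 0)
    by (intros p Hp; apply Hn; auto).
  destruct (local_log W2 (fun p => snd p * ((1 + s p) / 2)) q Ho2 Hq2)
    as (W3 & f2 & Ho3 & Hq3 & H32 & Hf2 & Ef2).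
  { apply holomorphic_iff. intros p Hp.
    assert (Hsp := Hsh p (H21 p Hp)). hol_tac. apply two_neq0. }
  { destruct (Hn q Hq1) as (? & ? & ?). apply Cmult_neq_0; [apply Hq |].
    apply Cmult_neq_0; [assumption |]. apply Cinv_neq0, two_neq0. }
  exists W3, s, (fun i => match i with c1 => f1 | c2 => f2 end).
  split; [exact Ho3 |]. split; [exact Hq3 |]. split; split.
  - intros p Hp. apply (proj1 Hs). auto.
  - intros p Hp. apply (proj2 Hs). auto.
  - intros [|]; [| exact Hf2]. intros p Hp. apply Hf1. auto.
  - intros p Hp. rewrite (Ef1 p (H32 p Hp)), (Ef2 p Hp).
    destruct (Hn2 p (H32 p Hp)) as (N1 & N2 & N3).
    assert (E : fst p = (1 - s p ^ 2) / 4).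
    { rewrite (proj2 Hs p (H21 p (H32 p Hp))). field. }
    assert (N4 := two_neq0). assert (N5 := four_neq0).
    assert (N6 : 1 + s p + (1 - s p) <> 0) by (replace (1 + s p + (1 - s p))
      with (RtoC 2) by ring; exact N4).
    split.
    + rewrite E. field. repeat split; auto.
    + field. auto.
Qed.

(** * The induced connection and its flat sections *)

Definition res_F (i : coord) (k j : nat) (q : C * C) : C :=
  match i, k, j with
  | c1, 1%nat, 3%nat => / (4 * fst q - 1)
  | c1, 3%nat, 3%nat => - 2 * / (4 * fst q - 1)
  | _, _, _ => 0
  end.

(** On G_0/theta G_0 this is minus the multiplication by dF/dq_i in the Jacobian ring of F(q, .). *)
Definition Phi_F (i : coord) (k j : nat) (q : C * C) : C :=
  match i, k, j with
  | c1, 3%nat, 0%nat => - / fst q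
  | c1, 2%nat, 1%nat => - / fst q
  | c1, 1%nat, 2%nat => - snd q
  | c1, 3%nat, 2%nat => 2 * snd q
  | c1, 0%nat, 3%nat => snd q * / (4 * fst q - 1)
  | c1, 2%nat, 3%nat => - 2 * / (4 * fst q - 1)
  | c2, 1%nat, 0%nat => - / snd q
  | c2, 0%nat, 1%nat => - (1)
  | c2, 2%nat, 1%nat => - 2 * / snd q
  | c2, 3%nat, 2%nat => 4 * fst q - 1
  | c2, 1%nat, 2%nat => - 2 * fst q
  | c2, 2%nat, 3%nat => - / snd q
  | _, _, _ => 0
  end.

(** Multiplication by F in the Jacobian ring. F is homogeneous of degree 1 when u1, u2, q1, q2 have
    weights 1, 1, 0, 2, so Euler's identity gives V0 = -2 q2 Phi along d/dq_2, and [Vinf_F] is the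
    diagonal matrix of the weights 0, 1, 2, 1 of omega_0, ..., omega_3. *)
Definition V0_F (k j : nat) (q : C * C) : C :=
  match k, j with
  | 1%nat, 0%nat => 2
  | 0%nat, 1%nat => 2 * snd q
  | 2%nat, 1%nat => 4
  | 3%nat, 2%nat => 2 * snd q * (1 - 4 * fst q)
  | 1%nat, 2%nat => 4 * fst q * snd q
  | 2%nat, 3%nat => 2
  | _, _ => 0
  end.

Definition Vinf_F (k j : nat) (q : C * C) : C :=
  match k, j with
  | 1%nat, 1%nat => 1
  | 2%nat, 2%nat => 2
  | 3%nat, 3%nat => 1
  | _, _ => 0
  end.

Definition conn_F : conn_data := ConnData res_F Phi_F V0_F Vinf_F.

(** Equality is asked on [M] and for indices up to 3, which is where [is_conn_data] determines the
    matrices. *)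
Definition agrees_F (b : conn_data) : Prop :=
  forall i k j q, (k <= 3)%nat -> (j <= 3)%nat -> M q ->
    res b i k j q = res_F i k j q /\ Phi b i k j q = Phi_F i k j q.

Lemma sum_n_3 (a : nat -> C) :
  sum_n a 3 = a 0%nat + a 1%nat + a 2%nat + a 3%nat.
Proof. rewrite !sum_Sn, sum_O. reflexivity. Qed.

Lemma period_F b X k q : agrees_F b -> (k <= 3)%nat -> M q ->
  period b X k q =
  match k with
  | 1%nat => X c2 q / snd q
  | 3%nat => X c1 q / fst q
  | _ => 0
  end.
Proof.
  intros Hb Hk Hq. unfold period.
  destruct (Hb c1 k 0%nat q Hk ltac:(lia) Hq) as [_ ->].
  destruct (Hb c2 k 0%nat q Hk ltac:(lia) Hq) as [_ ->].
  destruct Hq as (H1 & H2 & _).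
  destruct k as [|[|[|[|k]]]]; [| | | | lia]; simpl; try ring; field;
    assumption.
Qed.

Lemma open_in_M_locally W q : open_in_M W -> W q ->
  locally (T := C2_space) q
    (fun p => W p /\ M p).
Proof.
  intros [Wo WM] Hq. eapply filter_imp; [| exact (Wo q Hq)]. intros p Hp. auto.
Qed.

Lemma residual_period_F b W (X : vfield) i k q : agrees_F b -> open_in_M W ->
  (forall l, holomorphic W (X l)) -> (k <= 3)%nat -> W q ->
  residual b i (period b X) k q =
  match k with
  | 1%nat => pderiv i (fun p => X c2 p / snd p) q +
      match i with c1 => (X c1 q / fst q) / (4 * fst q - 1) | c2 => 0 end
  | 3%nat => pderiv i (fun p => X c1 p / fst p) q +
      match i with c1 => - 2 / (4 * fst q - 1) * (X c1 q / fst q) | c2 => 0 end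
  | _ => 0
  end.
Proof.
  intros Hb HW HX Hk Hq.
  assert (Mq : M q) by (apply HW; exact Hq).
  assert (Hh : forall l, hol_at (X l) q)
    by (intro l; exact (proj1 (holomorphic_iff _ _) (HX l) q Hq)).
  assert (H1 := Hh c1). assert (H2 := Hh c2).
  unfold residual. rewrite sum_n_3.
  rewrite !(period_F b X _ q Hb) by (lia || assumption).
  rewrite !(fun j Hj => proj1 (Hb i k j q Hk Hj Mq)) by lia.
  destruct Mq as (N1 & N2 & N3).
  (* The explicit form of the period holds only on [M]; the derivatives agree because [W] is a
     neighbourhood of q inside [M]. *)
  assert (E : pderiv i (period b X k) q = pderiv i (fun p =>
     match k with
  | 1%nat => X c2 p / snd p
  | 3%nat => X c1 p / fst p
  | _ => 0
  end) q).
  { apply pderiv_ext.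
    - eapply filter_imp; [| exact (open_in_M_locally W q HW Hq)].
      intros p [_ Mp]. symmetry. apply period_F; assumption.
    - destruct k as [|[|[|[|k]]]]; [| | | | lia]; hol_tac. }
  rewrite E.
  assert (Z : pderiv i (fun _ => 0) q = 0)
    by (destruct (grad_pderiv _ _ _ _ (grad_const 0 q)); destruct i;
      assumption).
  destruct k as [|[|[|[|k]]]]; [| | | | lia]; rewrite ?Z; destruct i; simpl;
    unfold Cdiv; ring.
Qed.

(** Transport of the residual connection along X |-> (X_2/q2) omega_1 + (X_1/q1) omega_3. The terms
    -1/q_i come from differentiating 1/q_i, the terms with 4 q1 - 1 from the derivative of
    omega_3. *)
Definition christoffel_F : christoffel := fun i k j q =>
  match i, k, j with
  | c1, c1, c1 => - / fst q - 2 / (4 * fst q - 1)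
  | c1, c2, c1 => snd q / (fst q * (4 * fst q - 1))
  | c2, c2, c2 => - / snd q
  | _, _, _ => 0
  end.

Lemma is_nabla_omega0_F b : agrees_F b -> is_nabla_omega0 b christoffel_F.
Proof.
  intro Hb. split.
  - intros i k j. apply holomorphic_iff. intros q Hq.
    assert (H3 := M_disc q Hq). destruct Hq as (N1 & N2 & N3).
    destruct i, k, j; unfold christoffel_F; hol_tac;
      repeat apply Cmult_neq_0; assumption.
  - intros W X HW HX i k q Hk Hq.
    assert (Mq : M q) by (apply HW; exact Hq).
    rewrite (residual_period_F b W X i k q Hb HW HX Hk Hq).
    rewrite period_F by assumption.
    assert (Hh : forall l, hol_at (X l) q)
      by (intro l; exact (proj1 (holomorphic_iff _ _) (HX l) q Hq)).
    assert (D := M_disc q Mq). destruct Mq as (N1 & N2 & N3).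
    assert (D1 := grad_mult _ _ _ _ _ _ _ (hol_grad _ _ (Hh c1)) (grad_inv _ _ _
      _ N1 (grad_fst q))).
    assert (D2 := grad_mult _ _ _ _ _ _ _ (hol_grad _ _ (Hh c2)) (grad_inv _ _ _
      _ N2 (grad_snd q))).
    apply grad_pderiv in D1. apply grad_pderiv in D2.
    destruct D1 as [D11 D12], D2 as [D21 D22]. unfold Cdiv in *.
    unfold covderiv.
    destruct k as [|[|[|[|k]]]]; [| | | | lia]; try reflexivity; destruct i;
      rewrite ?D11, ?D12, ?D21, ?D22; simpl; field; repeat split; assumption.
Qed.

(** The hypotheses say that the residual derivative of the period of X vanishes. This is the period
    of the covariant derivative, whose components on omega_3 and omega_1 are those of the covariant
    derivative divided by q1 and q2; hence the latter vanishes too. *)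
Lemma flat_F b G W (X : vfield) : agrees_F b -> is_nabla_omega0 b G ->
  open_in_M W -> (forall k, holomorphic W (X k)) ->
  (forall q, W q ->
     grad (fun p => X c1 p / fst p) q (2 / (4 * fst q - 1) * (X c1 q / fst q)) 0
       /\
     grad (fun p => X c2 p / snd p) q (- (X c1 q / fst q) / (4 * fst q - 1)) 0)
       ->
  flat G W X.
Proof.
  intros Hb [_ HG] HW HX Hgrad. split; [exact HX |]. intros i k q Hq.
  assert (Mq : M q) by (apply HW; exact Hq).
  destruct (Hgrad q Hq) as [H1 H2].
  apply grad_pderiv in H1. apply grad_pderiv in H2.
  destruct H1 as [H11 H12], H2 as [H21 H22].
  assert (H : forall n, (n <= 3)%nat -> period b (covderiv G i X) n q = 0).
  { intros n Hn. rewrite (HG W X HW HX i n q Hn Hq).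
    rewrite (residual_period_F b W X i n q Hb HW HX Hn Hq).
    assert (D := M_disc q Mq). destruct Mq as (N1 & N2 & N3).
    destruct n as [|[|[|[|n]]]]; [| | | | lia]; try reflexivity; destruct i;
      rewrite ?H11, ?H12, ?H21, ?H22; try ring; field; repeat split; assumption.
      }
  assert (E1 := H 3%nat ltac:(lia)). assert (E2 := H 1%nat ltac:(lia)).
  rewrite period_F in E1, E2 by (lia || assumption).
  destruct Mq as (N1 & N2 & _).
  destruct k.
  - replace (covderiv G i X c1 q) with (covderiv G i X c1 q / fst q * fst q) by
      (field; exact N1).
    rewrite E1. ring.
  - replace (covderiv G i X c2 q) with (covderiv G i X c2 q / snd q * snd q) by
      (field; exact N2).
    rewrite E2. ring.
Qed.

Lemma flat_xi2 b G W : agrees_F b -> is_nabla_omega0 b G -> open_in_M W -> flat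
  G W xi2.
Proof.
  intros Hb HG HW. apply (flat_F b); [assumption.. | |].
  - intro k. apply holomorphic_iff. intros q _.
    destruct k; unfold xi1, xi2; hol_tac.
  - intros q Hq. destruct (proj2 HW q Hq) as (N1 & N2 & N3). simpl. split.
    + eapply grad_eq; [apply (grad_ext (fun _ => 0)) | |].
      * apply filter_forall. intro p. unfold Cdiv. ring.
      * apply grad_const.
      * unfold Cdiv. ring.
      * reflexivity.
    + eapply grad_eq; [apply (grad_ext (fun _ => 1)) | |].
      * eapply filter_imp; [| exact (open_in_M_locally W q HW Hq)].
        intros p (_ & _ & N & _). field. exact N.
      * apply grad_const.
      * unfold Cdiv. ring.
      * reflexivity.
Qed.

(** Differentiating s^2 = 1 - 4 q1 gives 2 s ds = -4 dq1, and 4 q1 - 1 = -s^2 turns -2/s into 2 s /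
    (4 q1 - 1). *)
Lemma sqrt_branch_grad W s q : open_in_M W -> sqrt_branch W s -> W q ->
  grad s q (2 * s q / (4 * fst q - 1)) 0.
Proof.
  intros HW Hs Hq. destruct (sqrt_branch_neq W s q HW Hs Hq) as (_ & _ & N).
  destruct Hs as [Hh Es].
  assert (H := hol_grad s q (proj1 (holomorphic_iff _ _) Hh q Hq)).
  assert (D := M_disc q (proj2 HW q Hq)).
  assert (Hm := grad_mult _ _ _ _ _ _ _ H H).
  assert (Hr : grad (fun p => s p * s p) q (- (4)) 0).
  { eapply grad_eq.
    - apply (grad_ext (fun p => 1 + - (4 * fst p))).
      + eapply filter_imp; [| exact (open_in_M_locally W q HW Hq)].
        intros p [Wp _]. generalize (Es p Wp). simpl. rewrite Cmult_1_r.
        intros ->. ring.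
      + apply grad_plus; [apply grad_const |].
        apply (grad_opp (fun p => 4 * fst p)), grad_mult;
          [apply grad_const | apply grad_fst].
    - simpl. ring.
    - simpl. ring. }
  apply grad_pderiv in Hm. apply grad_pderiv in Hr.
  destruct Hm as [M1 M2], Hr as [R1 R2]. rewrite R1 in M1. rewrite R2 in M2.
  assert (T := two_neq0).
  assert (E : 4 * fst q - 1 = - (s q * s q)).
  { generalize (Es q Hq). simpl. rewrite Cmult_1_r. intros ->. ring. }
  eapply grad_eq; [exact H | |].
  - rewrite E.
    replace (pderiv c1 s q) with ((pderiv c1 s q * s q + s q * pderiv c1 s q) /
      (2 * s q)) by (field; auto).
    rewrite <- M1. field. auto.
  - replace (pderiv c2 s q) with ((pderiv c2 s q * s q + s q * pderiv c2 s q) /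
      (2 * s q)) by (field; auto).
    rewrite <- M2. field. auto.
Qed.

Lemma flat_xi1 b G W s : agrees_F b -> is_nabla_omega0 b G -> open_in_M W ->
  sqrt_branch W s -> flat G W (xi1 s).
Proof.
  intros Hb HG HW Hs. apply (flat_F b); [assumption.. | |].
  - intro k. apply holomorphic_iff. intros q Hq.
    assert (hol_at s q) by exact (proj1 (holomorphic_iff _ _) (proj1 Hs) q Hq).
    destruct k; unfold xi1, xi2; hol_tac; apply two_neq0.
  - intros q Hq. assert (H := sqrt_branch_grad W s q HW Hs Hq).
    assert (D := M_disc q (proj2 HW q Hq)).
    destruct (proj2 HW q Hq) as (N1 & N2 & N3). simpl. split.
    + eapply grad_eq; [apply (grad_ext (fun p => - s p)) | |].
      * eapply filter_imp; [| exact (open_in_M_locally W q HW Hq)].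
        intros p (_ & N & _). field. exact N.
      * apply grad_opp. exact H.
      * field. auto.
      * ring.
    + eapply grad_eq; [apply (grad_ext (fun p => / 2 * s p + / 2)) | |].
      * eapply filter_imp; [| exact (open_in_M_locally W q HW Hq)].
        intros p (_ & _ & N & _). assert (T := two_neq0). field. auto.
      * apply grad_plus; [| apply grad_const].
        apply grad_mult; [apply grad_const | exact H].
      * assert (T := two_neq0). simpl. field. auto.
      * simpl. ring.
Qed.

(** * The coordinate vector fields of phi *)

Lemma flat_ext G W (X Y : vfield) : open_in_M W ->
  (forall k q, W q -> X k q = Y k q) -> flat G W X -> flat G W Y.
Proof.
  intros HW E [Hh Hf].
  assert (Hl : forall k q, W q ->
    locally (T := C2_space) q (fun p => X k p = Y k p)).
  { intros k q Hq. eapply filter_imp; [| exact (open_in_M_locally W q HW Hq)].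
    intros p [Wp _]. apply E. exact Wp. }
  split.
  - intro k. apply holomorphic_iff. intros q Hq.
    apply (hol_ext (X k)); [apply Hl; exact Hq |].
    exact (proj1 (holomorphic_iff _ _) (Hh k) q Hq).
  - intros i k q Hq. rewrite <- (Hf i k q Hq). unfold covderiv.
    rewrite <- !E by exact Hq. f_equal. f_equal.
    apply pderiv_ext; [apply Hl; exact Hq |].
    exact (proj1 (holomorphic_iff _ _) (Hh k) q Hq).
Qed.

(* For this branch of (1 - 4 q1)^(1/2), d/dphi_1 = xi_1 and d/dphi_2 = xi_2. *)
Definition phi_sqrt (phi : coord -> C * C -> C) (q : C * C) : C :=
  (Cexp (phi c1 q) - 1) / (Cexp (phi c1 q) + 1).

Lemma phi_branch_neq0 W phi q : open_in_M W -> phi_branch W phi -> W q ->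
  Cexp (phi c1 q) + 1 <> 0.
Proof.
  intros HW [_ E] Hq H. destruct (E q Hq) as [_ E2].
  destruct (proj2 HW q Hq) as (_ & N & _). apply N. rewrite E2, H. ring.
Qed.

(** With E = e^phi_1, 1 - 4 E/(1 + E)^2 = ((E - 1)/(E + 1))^2. *)
Lemma phi_sqrt_branch W phi : open_in_M W -> phi_branch W phi ->
  sqrt_branch W (phi_sqrt phi).
Proof.
  intros HW Hphi. split.
  - apply holomorphic_iff. intros q Hq.
    assert (hol_at (fun p => Cexp (phi c1 p)) q).
    { eapply hol_comp; [| apply cder_Cexp].
      exact (proj1 (holomorphic_iff _ _) (proj1 Hphi c1) q Hq). }
    unfold phi_sqrt. hol_tac.
    exact (phi_branch_neq0 W phi q HW Hphi Hq).
  - intros q Hq. assert (N := phi_branch_neq0 W phi q HW Hphi Hq).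
    destruct (proj2 Hphi q Hq) as [-> _]. unfold phi_sqrt. field.
    rewrite Cplus_comm. auto.
Qed.

(** Implicit differentiation gives dq1 = -s q1 dphi_1 and dq2 = q2 (dphi_2 + (s + 1)/2 dphi_1);
    solving this triangular system yields the Jacobian of phi. *)
Lemma phi_grad W phi q : open_in_M W -> phi_branch W phi -> W q ->
  let s := phi_sqrt phi q in
  pderiv c1 (phi c1) q * (s * fst q) = - (1) /\ pderiv c2 (phi c1) q = 0 /\
  pderiv c1 (phi c2) q * (s * fst q) = / 2 * s + / 2 /\
  pderiv c2 (phi c2) q * snd q = 1.
Proof.
  intros HW Hphi Hq s.
  assert (N := phi_branch_neq0 W phi q HW Hphi Hq).
  assert (Hs := sqrt_branch_neq W _ q HW (phi_sqrt_branch W phi HW Hphi) Hq).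
  destruct Hs as (_ & _ & Ns). fold s in Ns.
  assert (N' : 1 + Cexp (phi c1 q) <> 0) by (rewrite Cplus_comm; exact N).
  assert (T := two_neq0).
  destruct (proj2 HW q Hq) as (N1 & N2 & _).
  destruct Hphi as [Hh E].
  assert (G1 := hol_grad _ _ (proj1 (holomorphic_iff _ _) (Hh c1) q Hq)).
  assert (G2 := hol_grad _ _ (proj1 (holomorphic_iff _ _) (Hh c2) q Hq)).
  set (a1 := pderiv c1 (phi c1) q) in *. set (b1 := pderiv c2 (phi c1) q) in *.
  set (a2 := pderiv c1 (phi c2) q) in *. set (b2 := pderiv c2 (phi c2) q) in *.
  assert (X1 := grad_comp _ _ _ _ _ _ G1 (cder_Cexp _)).
  assert (X2 := grad_comp _ _ _ _ _ _ G2 (cder_Cexp _)).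
  assert (Xp := grad_plus _ _ _ _ _ _ _ X1 (grad_const 1 q)).
  assert (Q1 : grad fst q (a1 * - (s * fst q)) (b1 * - (s * fst q))).
  { assert (Y := grad_mult _ _ _ _ _ _ _ X1 (grad_inv _ _ _ _ (Cmult_neq_0 _ _ N
      N) (grad_mult _ _ _ _ _ _ _ Xp Xp))).
    eapply grad_eq; [eapply grad_ext; [| exact Y] | |].
    - eapply filter_imp; [| exact (open_in_M_locally W q HW Hq)].
      intros p [Wp _]. destruct (E p Wp) as [-> _]. simpl. unfold Cdiv.
      rewrite Cmult_1_r, (Cplus_comm 1). reflexivity.
    - destruct (E q Hq) as [-> _]. unfold s, phi_sqrt. field. auto.
    - destruct (E q Hq) as [-> _]. unfold s, phi_sqrt. field. auto. }
  assert (Es : / 2 * s + / 2 = Cexp (phi c1 q) / (Cexp (phi c1 q) + 1)).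
  { unfold s, phi_sqrt. field. auto. }
  assert (Q2 : grad snd q (a2 * snd q + a1 * (/ 2 * s + / 2) * snd q)
                          (b2 * snd q + b1 * (/ 2 * s + / 2) * snd q)).
  { assert (Y := grad_mult _ _ _ _ _ _ _ X2 Xp).
    eapply grad_eq; [eapply grad_ext; [| exact Y] | |].
    - eapply filter_imp; [| exact (open_in_M_locally W q HW Hq)].
      intros p [Wp _]. destruct (E p Wp) as [_ ->]. reflexivity.
    - rewrite Es. destruct (E q Hq) as [_ ->]. field. auto.
    - rewrite Es. destruct (E q Hq) as [_ ->]. field. auto. }
  apply grad_pderiv in Q1. apply grad_pderiv in Q2.
  destruct (grad_pderiv _ _ _ _ (grad_fst q)) as [F1 F2].
  destruct (grad_pderiv _ _ _ _ (grad_snd q)) as [S1 S2].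
  rewrite F1, F2 in Q1. rewrite S1, S2 in Q2.
  destruct Q1 as [A1 B1], Q2 as [A2 B2].
  assert (Hb : b1 = 0).
  { replace b1 with (- (b1 * - (s * fst q)) / (s * fst q)) by (field; auto).
    rewrite <- B1. field. auto. }
  assert (Ha : a1 * (s * fst q) = - (1)) by (rewrite A1; ring).
  split; [exact Ha |]. split; [exact Hb |]. split.
  - replace (a2 * (s * fst q)) with
      ((a2 * snd q + a1 * (/ 2 * s + / 2) * snd q) * (s * fst q) / snd q
        - (a1 * (s * fst q)) * (/ 2 * s + / 2)) by (field; auto).
    rewrite <- A2, Ha. field. auto.
  - rewrite B2, Hb. ring.
Qed.

Lemma dual_frame_exists W phi : open_in_M W -> phi_branch W phi ->
  dual_frame W phi (fun i => match i with c1 => xi1 (phi_sqrt phi) | c2 => xi2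
    end).
Proof.
  intros HW Hphi i j q Hq.
  destruct (phi_grad W phi q HW Hphi Hq) as (E1 & E2 & E3 & E4).
  destruct i, j; unfold xi1, xi2; cbv beta iota.
  - rewrite E2. replace (pderiv c1 (phi c1) q * - (phi_sqrt phi q * fst q)) with
      (- (pderiv c1 (phi c1) q * (phi_sqrt phi q * fst q))) by ring.
    rewrite E1. ring.
  - replace (pderiv c1 (phi c2) q * - (phi_sqrt phi q * fst q)) with
      (- (pderiv c1 (phi c2) q * (phi_sqrt phi q * fst q))) by ring.
    replace (pderiv c2 (phi c2) q * ((/ 2 * phi_sqrt phi q + / 2) * snd q)) with
      ((pderiv c2 (phi c2) q * snd q) * (/ 2 * phi_sqrt phi q + / 2)) by ring.
    rewrite E3, E4. ring.
  - rewrite E2. ring.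
  - rewrite E4. ring.
Qed.

(** The Jacobian of phi is triangular with diagonal entries -1/(s q1) and 1/q2, hence invertible on
    [W]. Every dual frame is thus the one formed by xi_1 and xi_2. *)
Lemma dual_frame_unique W phi (Y Y' : coord -> vfield) :
  open_in_M W -> phi_branch W phi -> dual_frame W phi Y -> dual_frame W phi Y'
    ->
  forall i k q, W q -> Y i k q = Y' i k q.
Proof.
  intros HW Hphi HY HY' i k q Hq.
  destruct (phi_grad W phi q HW Hphi Hq) as (E1 & E2 & E3 & E4).
  assert (P1 := eq_trans (HY i c1 q Hq) (eq_sym (HY' i c1 q Hq))).
  assert (P2 := eq_trans (HY i c2 q Hq) (eq_sym (HY' i c2 q Hq))).
  rewrite E2 in P1.
  assert (H1 : Y i c1 q = Y' i c1 q).
  { assert (R : forall y, y = - ((pderiv c1 (phi c1) q * y + 0 * 0) * (phi_sqrt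
      phi q * fst q))).
    { intro y.
      replace (- ((pderiv c1 (phi c1) q * y + 0 * 0) * (phi_sqrt phi q * fst
        q)))
       with (- (pderiv c1 (phi c1) q * (phi_sqrt phi q * fst q)) * y) by ring.
       rewrite E1. ring. }
    rewrite (R (Y i c1 q)), (R (Y' i c1 q)). f_equal. f_equal.
    rewrite !Cmult_0_l in *. exact P1. }
  destruct k; [exact H1 |]. rewrite H1 in P2.
  assert (R : forall x y, y = (pderiv c1 (phi c2) q * x + pderiv c2 (phi c2) q *
    y - pderiv c1 (phi c2) q * x) * snd q).
  { intros x y.
    transitivity ((pderiv c2 (phi c2) q * snd q) * y); [rewrite E4; ring | ring].
    }
  rewrite (R (Y' i c1 q) (Y i c2 q)), P2. symmetry. apply R.
Qed.

Lemma dual_frame_flat b G W phi Y : agrees_F b -> is_nabla_omega0 b G ->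
  open_in_M W -> phi_branch W phi -> dual_frame W phi Y ->
  forall i, flat G W (Y i).
Proof.
  intros Hb HG HW Hphi HY i.
  eapply flat_ext; [exact HW | intros k q Hq;
    exact (dual_frame_unique W phi _ _ HW Hphi
    (dual_frame_exists W phi HW Hphi) HY i k q Hq) |].
  destruct i.
  - apply (flat_xi1 b); auto. apply phi_sqrt_branch; assumption.
  - apply (flat_xi2 b); assumption.
Qed.

(** * Laurent polynomials *)

Definition zpow (z : C) (n : Z) : C :=
  match n with
  | Z0 => 1
  | Zpos p => z ^ Pos.to_nat p
  | Zneg p => / z ^ Pos.to_nat p
  end.

Lemma zpow_of_nat (z : C) k : zpow z (Z.of_nat k) = z ^ k.
Proof.
  destruct k; [reflexivity |]. simpl. now rewrite SuccNat2Pos.id_succ.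
Qed.

Lemma zpow_opp_of_nat (z : C) k : zpow z (- Z.of_nat k) = / z ^ k.
Proof.
  destruct k; [simpl; field; apply C1_neq0 |].
  simpl. now rewrite SuccNat2Pos.id_succ.
Qed.

Lemma zpow_succ (z : C) n : z <> 0 -> zpow z (n + 1) = z * zpow z n.
Proof.
  intro Hz. destruct (Z_le_gt_dec 0 n) as [H | H].
  - rewrite <- (Z2Nat.id n H).
    replace (Z.of_nat (Z.to_nat n) + 1)%Z with (Z.of_nat (S (Z.to_nat n))) by
      lia.
    rewrite !zpow_of_nat. reflexivity.
  - replace n with (- Z.of_nat (S (Z.to_nat (- n - 1))))%Z at 2 by lia.
    replace (n + 1)%Z with (- Z.of_nat (Z.to_nat (- n - 1)))%Z by lia.
    rewrite !zpow_opp_of_nat, Cpow_S.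
    assert (z ^ Z.to_nat (- n - 1) <> 0) by (apply Cpow_nz; exact Hz).
    field. auto.
Qed.

Lemma Z_bi_ind (P : Z -> Prop) : P 0%Z -> (forall n, P n -> P (n + 1)%Z) ->
  (forall n, P n -> P (n - 1)%Z) -> forall n, P n.
Proof. intros H0 H1 H2. apply Z.peano_ind; assumption. Qed.

Lemma zpow_pred (z : C) n : z <> 0 -> zpow z (n - 1) = zpow z n * / z.
Proof.
  intro Hz. replace (zpow z n) with (zpow z (n - 1 + 1)) by (f_equal; lia).
  rewrite zpow_succ by exact Hz. field. exact Hz.
Qed.

Lemma zpow_add (z : C) m n : z <> 0 -> zpow z (m + n) = zpow z m * zpow z n.
Proof.
  intro Hz. revert n. apply Z_bi_ind.
  - rewrite Z.add_0_r. simpl. ring.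
  - intros n IH. rewrite Z.add_assoc, !zpow_succ, IH by exact Hz. ring.
  - intros n IH. replace (m + (n - 1))%Z with (m + n - 1)%Z by lia.
    rewrite !zpow_pred, IH by exact Hz. ring.
Qed.

Lemma zpow_mul (x y : C) n : x <> 0 -> y <> 0 -> zpow (x * y) n = zpow x n *
  zpow y n.
Proof.
  intros Hx Hy. assert (Hxy := Cmult_neq_0 _ _ Hx Hy). revert n. apply Z_bi_ind.
  - simpl. ring.
  - intros n IH. rewrite !zpow_succ, IH by assumption. ring.
  - intros n IH. rewrite !zpow_pred, IH by assumption. field. auto.
Qed.

Lemma zpow_one n : zpow 1 n = 1.
Proof.
  revert n. apply Z_bi_ind; [reflexivity | |]; intros n IH.
  - rewrite zpow_succ, IH by apply C1_neq0. ring.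
  - rewrite zpow_pred, IH by apply C1_neq0. field.
Qed.

(** 2 is not a root of unity, so rescaling a variable by 2 multiplies monomials of different degrees
    in it by different factors. *)
Lemma zpow_two_inj m n : zpow 2 m = zpow 2 n -> m = n.
Proof.
  assert (T := two_neq0).
  assert (H : forall p, (2 : C) ^ Pos.to_nat p <> 1).
  { intros p E. rewrite <- RtoC_pow in E. apply RtoC_inj in E.
    assert (1 < 2 ^ Pos.to_nat p)%R by (apply Rlt_pow_R1; [lra | lia]). lra. }
  intro E. assert (E' : zpow 2 (m - n) = 1).
  { replace m with (n + (m - n))%Z in E by lia.
    rewrite zpow_add in E by exact T.
    assert (N : zpow 2 n <> 0).
    { intro Z. apply C1_neq0.
      replace (RtoC 1) with (zpow 2 (n + - n)) by (rewrite Z.add_opp_diag_r;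
        reflexivity).
      rewrite zpow_add, Z by exact T. ring. }
    replace (zpow 2 (m - n)) with (zpow 2 n * zpow 2 (m - n) / zpow 2 n) by
      (field; exact N).
    rewrite E. field. exact N. }
  destruct (m - n)%Z eqn:D; [lia | |]; simpl in E'.
  - destruct (H p E').
  - destruct (H p).
    rewrite <- (Cinv_l (2 ^ Pos.to_nat p)) by (apply Cpow_nz; exact T).
    rewrite E'. ring.
Qed.

Lemma cder_ext f g z l : locally (T := C_UniformSpace) z (fun t => f t = g t) ->
  cder f z l -> cder g z l.
Proof. exact (cdiff_ext (U := C_NormedModule) f g z _). Qed.

Lemma cder_eq f z l l' : cder f z l -> l = l' -> cder f z l'.
Proof. intros H <-. exact H. Qed.

Lemma locally_C_neq0 (z : C) : z <> 0 -> locally (T := C_UniformSpace) z (fun t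
  : C => t <> 0).
Proof.
  intro Hz. apply (locally_Cmod z (Cmod z)); [apply Cmod_gt_0; exact Hz |].
  intros y Hy E. rewrite E in Hy. unfold Cminus in Hy.
  rewrite Cplus_0_l, Cmod_opp in Hy. lra.
Qed.

Lemma cder_mult f g z a b : cder f z a -> cder g z b ->
  cder (fun t => f t * g t) z (a * g z + f z * b).
Proof.
  intros Hf Hg.
  eapply cdiff_lin; [exact (cdiff_mult (U := C_NormedModule) f g z _ _ Hf Hg)
    |].
  intro h. cbv beta. ring.
Qed.

Lemma cder_zpow n (z : C) : z <> 0 -> cder (fun t => zpow t n) z (IZR n * zpow z
  (n - 1)).
Proof.
  intro Hz. revert n. apply Z_bi_ind.
  - simpl. eapply cdiff_lin; [apply cdiff_const |]. intro h. cbv beta. ring.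
  - intros n IH. eapply cder_eq.
    + eapply cder_ext; [| exact (cder_mult _ _ _ _ _ (cder_id z) IH)].
      eapply filter_imp; [| exact (locally_C_neq0 z Hz)].
      intros t Ht. symmetry. apply zpow_succ. exact Ht.
    + cbv beta. rewrite plus_IZR, RtoC_plus.
      replace (n + 1 - 1)%Z with (n - 1 + 1)%Z by lia.
      rewrite zpow_succ by exact Hz.
      replace (zpow z n) with (zpow z (n - 1 + 1)) by (f_equal; lia).
      rewrite zpow_succ by exact Hz. ring.
  - intros n IH. eapply cder_eq.
    + eapply cder_ext; [| exact (cder_mult _ _ _ _ _ IH (cder_inv z Hz))].
      eapply filter_imp; [| exact (locally_C_neq0 z Hz)].
      intros t Ht. symmetry. apply zpow_pred. exact Ht.
    + cbv beta. rewrite minus_IZR, RtoC_minus, !zpow_pred by exact Hz. field.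
      exact Hz.
Qed.

Definition mono (m n : Z) (u : C * C) : C := zpow (fst u) m * zpow (snd u) n.

Lemma mono_mul m n m' n' u : U u -> mono (m + m') (n + n') u = mono m n u * mono
  m' n' u.
Proof.
  intros [H1 H2]. unfold mono. rewrite !zpow_add by assumption. ring.
Qed.

Lemma grad_mono m n u : U u ->
  grad (mono m n) u (IZR m * mono (m - 1) n u) (IZR n * mono m (n - 1) u).
Proof.
  intros [H1 H2]. eapply grad_eq.
  - exact (grad_mult _ _ _ _ _ _ _
      (grad_comp fst (fun t => zpow t m) _ _ _ _ (grad_fst u) (cder_zpow m _
        H1))
      (grad_comp snd (fun t => zpow t n) _ _ _ _ (grad_snd u) (cder_zpow n _
        H2))).
  - unfold mono. ring.
  - unfold mono. ring.
Qed.

(* Lists of terms (coefficient, exponents); [lsum w] is the linear functional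
   with values [w] on monomials. *)
Definition laurent := list (C * (Z * Z)).

Fixpoint lsum (w : Z -> Z -> C) (l : laurent) : C :=
  match l with
  | [] => 0
  | (c, (m, n)) :: l => c * w m n + lsum w l
  end.

Lemma lsum_app w l l' : lsum w (l ++ l') = lsum w l + lsum w l'.
Proof.
  induction l as [|[c [m n]] l IH]; simpl; [ring | rewrite IH; ring].
Qed.

Lemma lsum_plus w w' l : lsum (fun m n => w m n + w' m n) l = lsum w l + lsum w'
  l.
Proof.
  induction l as [|[c [m n]] l IH]; simpl; [ring | rewrite IH; ring].
Qed.

Lemma lsum_scal a w l : lsum (fun m n => a * w m n) l = a * lsum w l.
Proof.
  induction l as [|[c [m n]] l IH]; simpl; [ring | rewrite IH; ring].
Qed.

Lemma lsum_ext w w' l : (forall m n, w m n = w' m n) -> lsum w l = lsum w' l.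
Proof.
  intro E.
  induction l as [|[c [m n]] l IH]; simpl; [ring | rewrite IH, E; ring].
Qed.

Definition lweight (a : Z -> Z -> C) (l : laurent) : laurent :=
  map (fun '(c, (m, n)) => (c * a m n, (m, n))) l.

Lemma lsum_lweight w a l : lsum w (lweight a l) = lsum (fun m n => a m n * w m
  n) l.
Proof.
  induction l as [|[c [m n]] l IH]; simpl; [ring | rewrite IH; ring].
Qed.

(* Rescaling a variable by 2 and subtracting a multiple kills the first term,
   whence an induction on the number of terms. *)
Lemma laurent_zero l : (forall u, U u -> lsum (fun m n => mono m n u) l = 0) ->
  forall w, lsum w l = 0.
Proof.
  assert (T := two_neq0). assert (N1 := C1_neq0).
  remember (length l) as k eqn:Hk. revert l Hk.
  induction k as [|k IH]; intros [|[c [m0 n0]] l] Hk H w; try discriminate;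
    [reflexivity |].
  injection Hk as Hk.
  assert (Hm : forall w, lsum (fun m n => (zpow 2 m - zpow 2 m0) * w m n) l =
    0).
  { intro w'. rewrite <- lsum_lweight.
    apply IH; [unfold lweight; now rewrite length_map |].
    intros u Hu. rewrite lsum_lweight.
    assert (E1 := H u Hu).
    assert (Hu2 : U (2 * fst u, snd u)) by (split; [apply Cmult_neq_0;
      [exact T | apply Hu] | apply Hu]).
    assert (E2 := H _ Hu2). simpl in E1, E2.
    assert (S : forall m n, mono m n (2 * fst u,
      snd u) = zpow 2 m * mono m n u).
    { intros m n. unfold mono. simpl. rewrite zpow_mul by (exact T || apply Hu).
      ring. }
    rewrite S in E2. rewrite (lsum_ext _ _ l S) in E2.
    rewrite (lsum_ext _ (fun m n => zpow 2 m * mono m n u + (- zpow 2 m0) * mono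
      m n u)) by (intros; ring).
    rewrite lsum_plus, lsum_scal.
    replace (lsum (fun m n => zpow 2 m * mono m n u) l) with (- (c * (zpow 2 m0
      * mono m0 n0 u)))
      by (rewrite <- (Cplus_0_r (- (c * _))), <- E2; ring).
    replace (lsum (fun m n => mono m n u) l) with (- (c * mono m0 n0 u))
      by (rewrite <- (Cplus_0_r (- (c * _))), <- E1; ring).
    ring. }
  assert (Hn : forall w, lsum (fun m n => (zpow 2 n - zpow 2 n0) * w m n) l =
    0).
  { intro w'. rewrite <- lsum_lweight.
    apply IH; [unfold lweight; now rewrite length_map |].
    intros u Hu. rewrite lsum_lweight.
    assert (E1 := H u Hu).
    assert (Hu2 : U (fst u, 2 * snd u)) by (split;
      [apply Hu | apply Cmult_neq_0; [exact T | apply Hu]]).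
    assert (E2 := H _ Hu2). simpl in E1, E2.
    assert (S : forall m n, mono m n (fst u,
      2 * snd u) = zpow 2 n * mono m n u).
    { intros m n. unfold mono. simpl. rewrite zpow_mul by (exact T || apply Hu).
      ring. }
    rewrite S in E2. rewrite (lsum_ext _ _ l S) in E2.
    rewrite (lsum_ext _ (fun m n => zpow 2 n * mono m n u + (- zpow 2 n0) * mono
      m n u)) by (intros; ring).
    rewrite lsum_plus, lsum_scal.
    replace (lsum (fun m n => zpow 2 n * mono m n u) l) with (- (c * (zpow 2 n0
      * mono m0 n0 u)))
      by (rewrite <- (Cplus_0_r (- (c * _))), <- E2; ring).
    replace (lsum (fun m n => mono m n u) l) with (- (c * mono m0 n0 u))
      by (rewrite <- (Cplus_0_r (- (c * _))), <- E1; ring).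
    ring. }
  assert (Hd : forall m m', m <> m' -> zpow 2 m - zpow 2 m' <> 0).
  { intros m m' Hne E. apply Hne, zpow_two_inj.
    replace (zpow 2 m) with (zpow 2 m - zpow 2 m' + zpow 2 m') by ring.
    rewrite E. ring. }
  assert (Hoff : forall w : Z -> Z -> C, (w m0 n0 = 0) -> lsum w l = 0).
  { intros w' Hw.
    (* Away from (m0, n0) one of 2^m - 2^m0 and 2^n - 2^n0 is invertible, so w is a sum of a
       multiple of each, and [Hm] and [Hn] apply. *)
    rewrite (lsum_ext _ (fun m n =>
      (zpow 2 m - zpow 2 m0) * (if Z.eq_dec m m0 then 0 else w' m n / (zpow 2 m
        - zpow 2 m0)) +
      (zpow 2 n - zpow 2 n0) * (if Z.eq_dec m m0 then w' m n / (zpow 2 n - zpow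
        2 n0) else 0))).
    - rewrite lsum_plus.
      rewrite (Hm (fun m n => if Z.eq_dec m m0 then 0 else w' m n / (zpow 2 m -
        zpow 2 m0))).
      rewrite (Hn (fun m n => if Z.eq_dec m m0 then w' m n / (zpow 2 n - zpow 2
        n0) else 0)). ring.
    - intros m n. destruct (Z.eq_dec m m0) as [-> | Hne].
      + destruct (Z.eq_dec n n0) as [-> | Hne].
        * rewrite Hw. unfold Cdiv. ring.
        * field. apply Hd. exact Hne.
      + field. apply Hd. exact Hne. }
  simpl.
  (* w is the constant w(m0, n0) plus weights vanishing at (m0, n0). For the constant 1, [lsum] is
     the value of the polynomial at u = (1, 1). *)
  rewrite (lsum_ext _ (fun m n => w m0 n0 * 1 + (w m n - w m0 n0))) by (intros;
    ring).
  rewrite lsum_plus, lsum_scal, (Hoff (fun m n => (w m n - w m0 n0)%C)) by ring.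
  assert (U1 : U (RtoC 1, RtoC 1)) by (split; exact N1).
  assert (E := H _ U1). simpl in E.
  assert (S : forall m n, mono m n (RtoC 1, RtoC 1) = 1).
  { intros m n. unfold mono. simpl. rewrite !zpow_one. ring. }
  rewrite S, (lsum_ext _ _ l S) in E.
  transitivity (w m0 n0 * (c * 1 + lsum (fun _ _ => 1) l)); [ring |]. rewrite E.
  ring.
Qed.

(** * Relations in the Brieskorn lattice *)

Lemma regular_pull {T T'} (D : T -> Prop) (D' : T' -> Prop) gens gens' (h : T'
  -> T) f :
  (forall x, D' x -> D (h x)) ->
  (forall g, In g gens -> In (fun x => g (h x)) gens') ->
  regular D gens f -> regular D' gens' (fun x => f (h x)).
Proof.
  intros HD Hg. induction 1.
  - apply reg_const.
  - apply reg_gen. auto.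
  - now apply (reg_add _ _ (fun x => f (h x)) (fun x => g (h x))).
  - now apply (reg_mul _ _ (fun x => f (h x)) (fun x => g (h x))).
  - apply (reg_ext _ _ _ (fun x => g (h x))); auto.
Qed.

Lemma regMth_of_regM f : regM f -> regMth (fun x => f (fst x)).
Proof.
  apply regular_pull.
  - intros [q th] [H _]. exact H.
  - intros g Hg. right. exact (in_map (fun f x => f (fst x)) _ _ Hg).
Qed.

Lemma regMthU_of_regMth f : regMth f -> regMthU (fun x => f (fst x)).
Proof.
  apply regular_pull.
  - intros [[q th] u] (H & H' & _). split; assumption.
  - intros g Hg. apply in_or_app. right.
    exact (in_map (fun f x => f (fst x)) _ _ Hg).
Qed.

Lemma reg_opp {T} (D : T -> Prop) gens f : regular D gens f -> regular D gens
  (fun x => - f x).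
Proof.
  intro H. apply (reg_ext _ _ _ (fun x => - (1) * f x)).
  - apply reg_mul; [apply reg_const | exact H].
  - intros; ring.
Qed.

Lemma reg_pow {T} (D : T -> Prop) gens f k : regular D gens f -> regular D gens
  (fun x => f x ^ k).
Proof.
  intro H.
  induction k as [|k IH]; simpl; [apply reg_const | now apply (reg_mul _ _ f
    (fun x => f x ^ k))].
Qed.

Ltac in_gens := simpl; repeat (first [left; reflexivity | right]).

Lemma regM_q1 : regM fst. Proof. apply reg_gen. in_gens. Qed.
Lemma regM_q2 : regM snd. Proof. apply reg_gen. in_gens. Qed.
Lemma regM_iq1 : regM (fun q => / fst q). Proof. apply reg_gen. in_gens. Qed.
Lemma regM_iq2 : regM (fun q => / snd q). Proof. apply reg_gen. in_gens. Qed.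
Lemma regM_disc : regM (fun q => / (4 * fst q - 1)). Proof. apply reg_gen.
in_gens. Qed.
Lemma regMth_th : regMth snd. Proof. apply reg_gen. in_gens. Qed.

Ltac reg_tac :=
  first [assumption | lazymatch goal with
  | |- regular _ _ (fun p => @?f p + @?g p) => apply (reg_add _ _ f g); reg_tac
  | |- regular _ _ (fun p => @?f p - @?g p) =>
      apply (reg_add _ _ f (fun p => - g p)); reg_tac
  | |- regular _ _ (fun p => @?f p * @?g p) => apply (reg_mul _ _ f g); reg_tac
  | |- regular _ _ (fun p => @?f p / @?g p) =>
      apply (reg_mul _ _ f (fun p => / g p)); reg_tac
  | |- regular _ _ (fun p => - @?f p) => apply (reg_opp _ _ f); reg_tac
  | |- regular _ _ (fun p => @?f p ^ ?k) => apply (reg_pow _ _ f k); reg_tac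
  | |- regular _ _ (fun p => snd p) => first [exact regM_q2 | exact regMth_th]
  | |- regular _ _ (fun p => fst p) => exact regM_q1
  | |- regular _ _ (fun p => / fst p) => exact regM_iq1
  | |- regular _ _ (fun p => / snd p) => exact regM_iq2
  | |- regular _ _ (fun p => / (RtoC 4 * fst p - RtoC 1)) => exact regM_disc
  | |- regular _ _ (fun p => fst (fst p)) => exact (regMth_of_regM _ regM_q1)
  | |- regular _ _ (fun p => snd (fst p)) => exact (regMth_of_regM _ regM_q2)
  | |- regular _ _ (fun p => / fst (fst p)) => exact (regMth_of_regM _ regM_iq1)
  | |- regular _ _ (fun p => / snd (fst p)) => exact (regMth_of_regM _ regM_iq2)
  | |- regular _ _ (fun p => / (RtoC 4 * fst (fst p) - RtoC 1)) => exact
    (regMth_of_regM _ regM_disc)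
  | |- regular _ _ _ => apply reg_const
  | |- _ => idtac
  end].

Ltac reg := unfold regM, regMth, regMthU; reg_tac.

Lemma regMthU_mono m n : regMthU (fun x => mono m n (snd x)).
Proof.
  assert (H : forall (f : C * C * C * (C * C) -> C) k,
    In f gensMthU -> In (fun x => / f x) gensMthU ->
    (forall x, MthU x -> f x <> 0) -> regMthU (fun x => zpow (f x) k)).
  { intros f k H1 H2 H3. destruct k; simpl.
    - apply reg_const.
    - apply reg_pow. apply reg_gen. exact H1.
    - apply (reg_ext _ _ _ (fun x => (/ f x) ^ Pos.to_nat p)).
      + apply reg_pow. apply reg_gen. exact H2.
      + intros x Hx. symmetry. apply Cpow_inv. auto. }
  unfold mono.
  apply (reg_mul _ _ (fun x => zpow (fst (snd x)) m) (fun x => zpow (snd (snd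
    x)) n)).
  - apply (H (fun x => fst (snd x))); [in_gens | in_gens |].
    intros [[q th] u] Hx. apply Hx.
  - apply (H (fun x => snd (snd x))); [in_gens | in_gens |].
    intros [[q th] u] Hx. apply Hx.
Qed.

Lemma open_U : open (T := C2_space) U.
Proof.
  intros u [H1 H2].
  apply filter_and; apply locally_neq0; auto; [apply hol_fst | apply hol_snd].
Qed.

(** [C_derive] is total and obeys the usual rules only where a derivative exists; this lemma
    supplies it for the coefficients of regular forms. In the case of [reg_ext] the openness of [U]
    makes equality on the domain a local equality. *)
Lemma regMthU_hol f q th u : regMthU f -> MthU (q, th,
  u) -> hol_at (fun v => f (q, th, v)) u.
Proof.
  intros Hf. revert u.
  induction Hf as [a | f Hf | f g _ IH1 _ IH2 | f g _ IH1 _ IH2 | f g _ IH E];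
    intros u Hu.
  - apply hol_const.
  - destruct Hu as (_ & _ & H1 & H2). simpl in Hf.
    repeat destruct Hf as [Hf | Hf]; try contradiction; subst f; simpl;
      lazymatch goal with
      | |- hol_at (fun v => fst v) _ => apply hol_fst
      | |- hol_at (fun v => snd v) _ => apply hol_snd
      | |- hol_at (fun v => / fst v) _ => apply (hol_inv fst);
        [assumption | apply hol_fst]
      | |- hol_at (fun v => / snd v) _ => apply (hol_inv snd);
        [assumption | apply hol_snd]
      | |- _ => apply hol_const
      end.
  - apply hol_plus; auto.
  - apply hol_mult; auto.
  - apply (hol_ext (fun v => g (q, th, v))); [| auto].
    destruct Hu as (H1 & H2 & Hu).
    eapply filter_imp; [| exact (open_U u Hu)]. intros v Hv. symmetry. apply E.
    repeat split; apply H1 || apply Hv || exact H2.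
Qed.

(** The zero class: [eqG0 eta eta'] is, up to conversion, [null] of the difference. *)
Definition null (eta : twoform) : Prop :=
  exists al : oneform, (forall i, regMthU (al i)) /\
    forall x, MthU x -> eta x = twisted_d al x.

Lemma grad_F_u (q u : C * C) : U u ->
  grad (F q) u (1 - fst q * (snd u ^ 2 / fst u ^ 2))
    (1 + 2 * fst q * (snd u / fst u) - snd q / snd u ^ 2).
Proof.
  intros [H1 H2].
  assert (G := grad_plus _ _ _ _ _ _ _ (grad_plus _ _ _ _ _ _ _ (grad_plus _ _ _
    _ _ _ _
     (grad_fst u) (grad_snd u)) (grad_mult _ _ _ _ _ _ _ (grad_const (fst q) u)
       (grad_mult _ _ _ _ _ _ _ (grad_mult _ _ _ _ _ _ _ (grad_snd u) (grad_snd
         u)) (grad_inv _ _ _ _ H1 (grad_fst u)))))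
    (grad_mult _ _ _ _ _ _ _ (grad_const (snd q) u) (grad_inv _ _ _ _ H2
      (grad_snd u)))).
  eapply grad_eq; [eapply grad_ext; [| exact G] | |].
  - apply filter_forall. intro v. unfold F, Cdiv. simpl. rewrite Cmult_1_r.
    reflexivity.
  - simpl. field. auto.
  - simpl. field. auto.
Qed.

Lemma twisted_d_eq al q th u a1 a2 b1 b2 :
  U u -> grad (fun v => al c1 (q, th, v)) u a1 a2 ->
  grad (fun v => al c2 (q, th, v)) u b1 b2 ->
  twisted_d al (q, th, u) = th * (b1 - a2)
    - ((1 - fst q * (snd u ^ 2 / fst u ^ 2)) * al c2 (q, th, u)
       - (1 + 2 * fst q * (snd u / fst u) - snd q / snd u ^ 2) * al c1 (q, th,
           u)).
Proof.
  intros Hu Ha Hb. apply grad_pderiv in Ha. apply grad_pderiv in Hb.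
  destruct (grad_pderiv _ _ _ _ (grad_F_u q u Hu)) as [F1 F2].
  unfold twisted_d. destruct Ha as [_ ->], Hb as [-> _]. rewrite F1, F2.
  reflexivity.
Qed.

Lemma null_ext eta eta' : null eta -> (forall x,
  MthU x -> eta' x = eta x) -> null eta'.
Proof.
  intros (al & Hal & E) E'. exists al. split; [exact Hal |].
  intros x Hx. rewrite E' by exact Hx. auto.
Qed.

Lemma null_add eta eta' : null eta -> null eta' -> null (fun x => eta x + eta'
  x).
Proof.
  intros (al & Hal & E) (al' & Hal' & E').
  exists (fun i x => al i x + al' i x). split.
  - intro i. exact (reg_add _ _ _ _ (Hal i) (Hal' i)).
  - intros [[q th] u] Hx. rewrite E, E' by exact Hx.
    assert (Hu : U u) by apply Hx.
    assert (H := fun i => hol_grad _ _ (regMthU_hol _ q th u (Hal i) Hx)).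
    assert (H' := fun i => hol_grad _ _ (regMthU_hol _ q th u (Hal' i) Hx)).
    rewrite (twisted_d_eq _ _ _ _ _ _ _ _ Hu (H c1) (H c2)).
    rewrite (twisted_d_eq _ _ _ _ _ _ _ _ Hu (H' c1) (H' c2)).
    rewrite (twisted_d_eq (fun i x => al i x + al' i x) _ _ _ _ _ _ _ Hu
      (grad_plus _ _ _ _ _ _ _ (H c1) (H' c1)) (grad_plus _ _ _ _ _ _ _ (H c2)
        (H' c2))).
    ring.
Qed.

(** theta d - dF /\ is linear over functions of q and theta, because d differentiates in u only. *)
Lemma null_scal c eta : regMth c -> null eta -> null (fun x => c (fst x) * eta
  x).
Proof.
  intros Hc (al & Hal & E).
  exists (fun i x => c (fst x) * al i x). split.
  - intro i.
    exact (reg_mul _ _ (fun x => c (fst x)) _ (regMthU_of_regMth c Hc) (Hal i)).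
  - intros [[q th] u] Hx. rewrite E by exact Hx.
    assert (Hu : U u) by apply Hx.
    assert (H := fun i => hol_grad _ _ (regMthU_hol _ q th u (Hal i) Hx)).
    rewrite (twisted_d_eq _ _ _ _ _ _ _ _ Hu (H c1) (H c2)).
    rewrite (twisted_d_eq (fun i x => c (fst x) * al i x) _ _ _ _ _ _ _ Hu
      (grad_mult _ _ _ _ _ _ _ (grad_const (c (q,
        th)) u) (H c1)) (grad_mult _ _ _ _ _ _ _ (grad_const (c (q,
        th)) u) (H c2))).
    simpl. ring.
Qed.

(* The coefficient on du1 /\ du2 of u1^m u2^n du1/u1 /\ du2/u2. *)
Definition e (m n : Z) (u : C * C) : C := mono (m - 1) (n - 1) u.

Lemma mono_e m n u : mono m n u = e (m + 1) (n + 1) u.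
Proof. unfold e. f_equal; lia. Qed.

(* (theta D_i - D_i F) (u1^m u2^n) du1/u1 /\ du2/u2, where D_i = u_i d/du_i. *)
Definition rel (i : coord) (m n : Z) : twoform := fun '(q, th, u) =>
  match i with
  | c1 => th * IZR m * e m n u - e (m + 1) n u + fst q * e (m - 1) (n + 2) u
  | c2 => th * IZR n * e m n u - e m (n + 1) u - 2 * fst q * e (m - 1) (n + 2) u
          + snd q * e m (n - 1) u
  end.

Lemma mono_shift a b m n m' n' u : U u -> (m' = m + a)%Z -> (n' = n + b)%Z ->
  mono m' n' u = mono m n u * (zpow (fst u) a * zpow (snd u) b).
Proof. intros Hu -> ->. exact (mono_mul m n a b u Hu). Qed.

(** The primitives are u1^m u2^n du2/u2 for the first family and -u1^m u2^n du1/u1 for the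
    second. *)
Lemma null_rel i m n : null (rel i m n).
Proof.
  exists (fun j x => match i, j return C with
    | c1, c2 => mono m (n - 1) (snd x)
    | c2, c1 => - mono (m - 1) n (snd x)
    | _, _ => RtoC 0 end).
  split.
  - intro j.
    destruct i, j; first [apply reg_const | apply regMthU_mono | apply reg_opp,
      regMthU_mono].
  - intros [[q th] u] Hx. assert (Hu : U u) by apply Hx.
    assert (HU := Hu). destruct HU as [N1 N2].
    destruct i.
    + erewrite twisted_d_eq; [| exact Hu | apply grad_const | apply grad_mono;
        exact Hu].
      unfold rel, e. simpl snd. cbv beta.
      rewrite (mono_shift 1 0 (m - 1) (n - 1) (m + 1 - 1) (n - 1)) by (auto;
        lia).
      rewrite (mono_shift (-1) 2 (m - 1) (n - 1) (m - 1 - 1) (n + 2 - 1)) by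
        (auto; lia).
      rewrite (mono_shift 1 0 (m - 1) (n - 1) m (n - 1)) by (auto; lia).
      simpl. field. auto.
    + erewrite twisted_d_eq; [| exact Hu | | apply grad_const].
      2: apply (grad_opp (mono (m - 1) n)); apply grad_mono; exact Hu.
      unfold rel, e. simpl snd. cbv beta.
      rewrite (mono_shift 0 1 (m - 1) (n - 1) (m - 1) (n + 1 - 1)) by (auto;
        lia).
      rewrite (mono_shift (-1) 2 (m - 1) (n - 1) (m - 1 - 1) (n + 2 - 1)) by
        (auto; lia).
      rewrite (mono_shift 0 (-1) (m - 1) (n - 1) (m - 1) (n - 1 - 1)) by (auto;
        lia).
      rewrite (mono_shift 0 1 (m - 1) (n - 1) (m - 1) n) by (auto; lia).
      simpl. field. auto.
Qed.

(** * Laurent expansions and functionals vanishing on the relations *)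

Definition eval (l : laurent) (u : C * C) : C := lsum (fun m n => mono m n u) l.

(** Linear substitution of [f m n] for u1^m u2^n; both products and differential operators take this
    form. *)
Definition lexpand (f : Z -> Z -> laurent) (l : laurent) : laurent :=
  flat_map (fun '(c, (m, n)) => map (fun '(d, k) => (c * d, k)) (f m n)) l.

Lemma lsum_map_scal w c l : lsum w (map (fun '(d, k) => (c * d,
  k)) l) = c * lsum w l.
Proof.
  induction l as [|[d [m n]] l IH]; simpl; [ring | rewrite IH; ring].
Qed.

Lemma lsum_lexpand w f l : lsum w (lexpand f l) = lsum (fun m n => lsum w (f m
  n)) l.
Proof.
  induction l as [|[c [m n]] l IH]; simpl; [reflexivity |].
  rewrite lsum_app, lsum_map_scal, IH. reflexivity.
Qed.

Definition is_laurent (f : C * C -> C) : Prop :=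
  exists l, forall u, U u -> f u = eval l u.

(** Once q and theta are fixed, the generators that depend on them become constants and only u1, u2
    and their inverses remain. *)
Lemma regMthU_laurent f q (th : C) : regMthU f -> M q -> th <> 0 -> is_laurent
  (fun u => f (q, th, u)).
Proof.
  intros Hf Hq Hth.
  assert (Hc : forall c, is_laurent (fun _ => c)).
  { intro c. exists [(c, (0, 0)%Z)]. intros u _. unfold eval, mono. simpl. ring.
    }
  assert (Hm : forall m n, is_laurent (mono m n)).
  { intros m n. exists [(RtoC 1, (m, n))]. intros u _. unfold eval. simpl. ring.
    }
  assert (He : forall f g, is_laurent f -> (forall u,
    U u -> g u = f u) -> is_laurent g).
  { intros g g' [l E] E'. exists l. intros u Hu. rewrite E' by exact Hu. auto. }
  induction Hf as [a | f Hf | f g _ [l1 E1] _ [l2 E2] | f g _ [l1 E1] _ [l2 E2]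
    | f g _ IH E].
  - apply Hc.
  - repeat destruct Hf as [Hf | Hf]; try contradiction; subst f; simpl;
      try apply Hc.
    + apply (He (mono 1 0)); [apply Hm |]. intros u _. unfold mono. simpl. ring.
    + apply (He (mono 0 1)); [apply Hm |]. intros u _. unfold mono. simpl. ring.
    + apply (He (mono (-1) 0)); [apply Hm |]. intros u [H1 H2]. unfold mono.
      simpl. field. exact H1.
    + apply (He (mono 0 (-1))); [apply Hm |]. intros u [H1 H2]. unfold mono.
      simpl. field. exact H2.
  - exists (l1 ++ l2). intros u Hu. unfold eval.
    rewrite lsum_app, E1, E2 by exact Hu. reflexivity.
  - exists (lexpand (fun m n => lexpand (fun m' n' => [(RtoC 1, (m + m',
      n + n')%Z)]) l2) l1).
    intros u Hu. unfold eval. rewrite lsum_lexpand, E1, E2 by exact Hu.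
    rewrite (lsum_ext _ (fun m n => eval l2 u * mono m n u)).
    + rewrite lsum_scal. unfold eval. ring.
    + intros m n. rewrite lsum_lexpand. simpl.
      rewrite (lsum_ext _ (fun m' n' => mono m n u * mono m' n' u))
        by (intros; rewrite mono_mul by exact Hu; ring).
      rewrite lsum_scal. unfold eval. ring.
  - apply (He (fun u => g (q, th, u))); [exact IH |].
    intros u Hu. apply E. repeat split; assumption || apply Hq || apply Hu.
Qed.

Lemma grad_eval l u : U u ->
  grad (eval l) u (lsum (fun m n => IZR m * mono (m - 1) n u) l)
    (lsum (fun m n => IZR n * mono m (n - 1) u) l).
Proof.
  intro Hu. induction l as [|[c [m n]] l IH].
  - apply grad_const.
  - eapply grad_eq; [exact (grad_plus _ _ _ _ _ _ _ (grad_mult _ _ _ _ _ _ _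
      (grad_const c u) (grad_mono m n u Hu)) IH) | |];
    simpl; ring.
Qed.

(* [v m n] is the value on u1^m u2^n du1/u1 /\ du2/u2 of a functional vanishing
   on the image of theta d - dF /\. *)
Definition period_weight (q : C * C) (th : C) (v : Z -> Z -> C) : Prop :=
  (forall m n, th * IZR m * v m n = v (m + 1)%Z n - fst q * v (m - 1)%Z (n +
    2)%Z) /\
  (forall m n, th * IZR n * v m n =
     v m (n + 1)%Z + 2 * fst q * v (m - 1)%Z (n + 2)%Z - snd q * v m (n - 1)%Z).

(** The coefficients of the primitive are Laurent polynomials, so the form has a second expansion L,
    made of images of monomials, and the weights kill each of these. The two expansions agree as
    functions on [U], hence under every functional by [laurent_zero]. The shift by 1 is that between
    u1^m u2^n du1 /\ du2 and e(m+1, n+1). *)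
Lemma null_weight eta q (th : C) l v : null eta -> M q -> th <> 0 ->
  (forall u, U u -> eta (q, th, u) = eval l u) -> period_weight q th v ->
  lsum (fun m n => v (m + 1)%Z (n + 1)%Z) l = 0.
Proof.
  intros (al & Hal & E) Hq Hth El [R1 R2].
  destruct (regMthU_laurent _ q th (Hal c1) Hq Hth) as [l1 E1].
  destruct (regMthU_laurent _ q th (Hal c2) Hq Hth) as [l2 E2].
  (* Images under theta d - dF /\ of u1^m u2^n du2 for [f2] and of u1^m u2^n du1 for [f1]. *)
  set (f2 := fun m n => [(th * IZR m, (m - 1, n)%Z); (- (1), (m, n));
    (fst q, (m - 2, n + 2)%Z)] : laurent).
  set (f1 := fun m n => [(- (th * IZR n), (m, n - 1)%Z); (RtoC 1, (m, n));
    (2 * fst q, (m - 1, n + 1)%Z); (- snd q, (m, n - 2)%Z)] : laurent).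
  set (L := lexpand f2 l2 ++ lexpand f1 l1).
  assert (EL : forall u, U u -> eval l u = eval L u).
  { intros u Hu. assert (HU := Hu). destruct HU as [N1 N2].
    assert (Hx : MthU (q, th, u)) by (repeat split; assumption || apply Hq).
    rewrite <- El, E by assumption.
    assert (Hl : forall f l, (forall u, U u -> f u = eval l u) ->
      grad f u (lsum (fun m n => IZR m * mono (m - 1) n u) l) (lsum (fun m n =>
        IZR n * mono m (n - 1) u) l)).
    { intros f l0 Ef. apply (grad_ext (eval l0)); [| apply grad_eval; exact Hu].
      eapply filter_imp; [| exact (open_U u Hu)]. intros v' Hv. symmetry.
      apply Ef. exact Hv. }
    rewrite (twisted_d_eq _ _ _ _ _ _ _ _ Hu (Hl _ _ E1) (Hl _ _ E2)).
    rewrite E1, E2 by exact Hu.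
    unfold L, eval. rewrite lsum_app, !lsum_lexpand.
    set (F1 := 1 - fst q * (snd u ^ 2 / fst u ^ 2)).
    set (F2 := 1 + 2 * fst q * (snd u / fst u) - snd q / snd u ^ 2).
    rewrite (lsum_ext (fun m n => lsum _ (f2 m n)) (fun m n => th * (IZR m *
      mono (m - 1) n u) + - F1 * mono m n u)).
    rewrite (lsum_ext (fun m n => lsum _ (f1 m n)) (fun m n => - th * (IZR n *
      mono m (n - 1) u) + F2 * mono m n u)).
    - rewrite !lsum_plus, !lsum_scal. ring.
    - intros m n. simpl. unfold F2.
      rewrite (mono_shift (-1) 1 m n (m - 1) (n + 1) u) by (auto; lia).
      rewrite (mono_shift 0 (-2) m n m (n - 2) u) by (auto; lia).
      simpl. field. auto.
    - intros m n. simpl. unfold F1.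
      rewrite (mono_shift (-2) 2 m n (m - 2) (n + 2) u) by (auto; lia).
      simpl. field. auto. }
  set (w := fun m n => v (m + 1)%Z (n + 1)%Z).
  assert (Z : lsum w (l ++ map (fun '(d, k) => (- (1) * d, k)) L) = 0).
  { apply laurent_zero. intros u Hu. rewrite lsum_app, lsum_map_scal.
    change (eval l u + - (1) * eval L u = 0). rewrite EL by exact Hu. ring. }
  rewrite lsum_app, lsum_map_scal in Z.
  assert (ZL : lsum w L = 0).
  { unfold L. rewrite lsum_app, !lsum_lexpand.
    rewrite (lsum_ext _ (fun _ _ => 0 * 0)).
    rewrite (lsum_ext (fun m n => lsum w (f1 m n)) (fun _ _ => 0 * 0)).
    - rewrite !lsum_scal. ring.
    - intros m n. simpl. unfold w.
      assert (E' := R2 (m + 1)%Z n).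
      replace (n - 1 + 1)%Z with n by lia. replace (m - 1 + 1)%Z with m by lia.
      replace (n + 1 + 1)%Z with (n + 2)%Z by lia.
      replace (n - 2 + 1)%Z with (n - 1)%Z by lia.
      replace (m + 1 - 1)%Z with m in E' by lia.
      match goal with |- ?G = _ => transitivity (v (m + 1)%Z (n + 1)%Z + 2 * fst
        q * v m (n + 2)%Z - snd q * v (m + 1)%Z (n - 1)%Z - th * IZR n * v (m +
        1)%Z n) end; [ring |].
      rewrite E'. ring.
    - intros m n. simpl. unfold w.
      assert (E' := R1 m (n + 1)%Z).
      replace (m - 1 + 1)%Z with m by lia.
      replace (m - 2 + 1)%Z with (m - 1)%Z by lia.
      replace (n + 1 + 2)%Z with (n + 2 + 1)%Z in E' by lia.
      match goal with |- ?G = _ => transitivity (th * IZR m * v m (n + 1)%Z - (v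
        (m + 1)%Z (n + 1)%Z - fst q * v (m - 1)%Z (n + 2 + 1)%Z)) end; [ring |].
      rewrite E'. ring. }
  rewrite ZL in Z. rewrite <- Z. ring.
Qed.

(** The sequence is built upwards from 0 with f and downwards with g; since f undoes a step of g,
    the same upward law holds at negative indices. *)
Lemma bi_rec {S : Type} (f g : Z -> S -> S) (s0 : S) :
  (forall n s, f n (g n s) = s) ->
  exists s : Z -> S, s 0%Z = s0 /\ forall n, s (n + 1)%Z = f n (s n).
Proof.
  intro Hfg.
  set (P := nat_rect (fun _ => S) s0 (fun k => f (Z.of_nat k))).
  set (N := nat_rect (fun _ => S) s0 (fun k => g (- Z.of_nat k - 1)%Z)).
  exists (fun n => if (0 <=? n)%Z then P (Z.to_nat n) else N (Z.to_nat (- n))).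
  split; [reflexivity |]. intro n.
  destruct (Z_le_gt_dec 0 n) as [H | H].
  - replace (0 <=? n + 1)%Z with true by (symmetry; apply Z.leb_le; lia).
    replace (0 <=? n)%Z with true by (symmetry; apply Z.leb_le; lia).
    replace (Z.to_nat (n + 1)) with (Datatypes.S (Z.to_nat n)) by lia.
    simpl. rewrite Z2Nat.id by exact H. reflexivity.
  - replace (0 <=? n)%Z with false by (symmetry; apply Z.leb_gt; lia).
    replace (Z.to_nat (- n)) with (Datatypes.S (Z.to_nat (- n - 1))) by lia.
    simpl. replace (- Z.of_nat (Z.to_nat (- n - 1)) - 1)%Z with n by lia.
    rewrite Hfg. destruct (Z.eq_dec n (-1)) as [-> | Hn]; [reflexivity |].
    replace (0 <=? n + 1)%Z with false by (symmetry; apply Z.leb_gt; lia).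
    f_equal. lia.
Qed.

Lemma period_weight_exists q (th : C) (x0 x1 x2 x3 : C) : M q ->
  exists v, period_weight q th v /\
    v 0%Z 0%Z = x0 /\ v 0%Z (-1)%Z = x1 /\ v (-1)%Z 1%Z = x2 /\ v (-1)%Z 2%Z =
      x3.
Proof.
  intro Hq. assert (D := M_disc q Hq). destruct Hq as (N1 & N2 & _).
  set (q1 := fst q) in *. set (q2 := snd q) in *.
  assert (D' : 1 - 4 * q1 <> 0).
  { intro E. apply D. replace (4 * q1 - 1) with (- (1 - 4 * q1)) by ring.
    rewrite E. ring. }
  (* The value a_(n+1), by elimination of b_(n+2) from a_(n+1) + 2 q1 b_(n+2) = theta n a_n + q2
     a_(n-1) and 2 a_(n+1) + b_(n+2) = theta (n-1) b_(n+1) + q2 b_n; the determinant is 1 - 4 q1.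
     The second equation is the second family on column -1 with column -2 eliminated by the first
     family. *)
  set (fa := fun n (a a' b b' : C) =>
    (th * IZR n * a + q2 * a' - 2 * q1 * (th * IZR (n - 1) * b + q2 * b')) / (1
      - 4 * q1)).
  (* State at n: a_n, a_(n-1), b_(n+1), b_n, with a_n = v 0 n, b_n = v (-1) n. *)
  set (f := fun n (s : C * C * C * C) => let '(a, a', b, b') := s in
    let a2 := fa n a a' b b' in
    (a2, a, th * IZR (n - 1) * b + q2 * b' - 2 * a2, b)).
  set (g := fun n (s : C * C * C * C) => let '(a2, a, b2, b) := s in
    (a, (a2 + 2 * q1 * b2 - th * IZR n * a) / q2,
     b, (b2 + 2 * a2 - th * IZR (n - 1) * b) / q2)).
  assert (Hfg : forall n s, f n (g n s) = s).
  { intros n [[[a2 a] b2] b]. unfold f, g.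
    assert (E : fa n a ((a2 + 2 * q1 * b2 - th * IZR n * a) / q2) b ((b2 + 2 *
      a2 - th * IZR (n - 1) * b) / q2) = a2).
    { unfold fa. field. auto. }
    rewrite E. f_equal. f_equal. field. exact N2. }
  (* The state at 0 contains b_0, whereas b_2 is prescribed; this value of b_0 is the one for which
     b_2 = x3. *)
  destruct (bi_rec f g (x0, x1, x2,
    ((1 - 4 * q1) * x3 + th * x2 + 2 * q2 * x1) / q2) Hfg)
    as (s & s0 & Hs).
  set (a := fun n => let '(a, _, _, _) := s n in a).
  set (b := fun n => let '(_, _, _, b) := s n in b).
  assert (Es : forall n, s n = (a n, a (n - 1)%Z, b (n + 1)%Z, b n)).
  { intro n. assert (H1 := Hs n). assert (H2 := Hs (n - 1)%Z).
    replace (n - 1 + 1)%Z with n in H2 by lia. unfold a, b. rewrite H1.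
    rewrite H2 at 1.
    destruct (s n) as [[[y1 y2] y3] y4] eqn:En.
    destruct (s (n - 1)%Z) as [[[z1 z2] z3] z4]. unfold f in *.
    injection H2 as -> -> -> ->. reflexivity. }
  assert (Ea : forall n, a (n + 1)%Z = fa n (a n) (a (n - 1)%Z) (b (n + 1)%Z) (b
    n)).
  { intro n. unfold a at 1. rewrite Hs, Es. reflexivity. }
  assert (Eb : forall n, b (n + 2)%Z = th * IZR (n - 1) * b (n + 1)%Z + q2 * b n
    - 2 * a (n + 1)%Z).
  { intro n. rewrite Ea. assert (H := Hs n). rewrite !Es in H. unfold f in H.
    apply (f_equal (fun s => snd (fst s))) in H. cbn [fst snd] in H.
    replace (n + 2)%Z with (n + 1 + 1)%Z by lia. exact H. }
  clearbody a b.
  assert (B0 : (a 0%Z, a (-1)%Z, b 1%Z, b 0%Z) =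
    (x0, x1, x2, ((1 - 4 * q1) * x3 + th * x2 + 2 * q2 * x1) / q2)).
  { rewrite <- s0, (Es 0%Z). reflexivity. }
  injection B0 as A0 A1 B1 B0.
  (* The state at m is the pair of columns m and m - 1. The first family gives column m + 1 from it
     ([F]), and gives column m - 1 from columns m + 1 and m ([G], dividing by q1). *)
  set (F := fun m (c : (Z -> C) * (Z -> C)) =>
    ((fun n => q1 * snd c (n + 2)%Z + th * IZR m * fst c n), fst c)).
  set (G := fun m (c : (Z -> C) * (Z -> C)) =>
    (snd c, fun n => (fst c (n - 2)%Z - th * IZR m * snd c (n - 2)%Z) / q1)).
  assert (HFG : forall m c, F m (G m c) = c).
  { intros m [c c']. unfold F, G. simpl. f_equal.
    apply functional_extensionality. intro n.
    replace (n + 2 - 2)%Z with n by lia. field. exact N1. }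
  destruct (bi_rec F G (a, b) HFG) as (t & t0 & Ht).
  set (v := fun m => fst (t m)).
  assert (Ev : forall m, snd (t m) = v (m - 1)%Z).
  { intro m. unfold v. replace m with (m - 1 + 1)%Z at 1 by lia. rewrite Ht.
    reflexivity. }
  assert (R1 : forall m n, th * IZR m * v m n = v (m + 1)%Z n - q1 * v (m - 1)%Z
    (n + 2)%Z).
  { intros m n. unfold v at 2. rewrite Ht. simpl. rewrite Ev. unfold v. ring. }
  assert (V0 : forall n, v 0%Z n = a n) by (intro n; unfold v; rewrite t0;
    reflexivity).
  assert (V1 : forall n, v (-1)%Z n = b n).
  { intro n. change (-1)%Z with (0 - 1)%Z. rewrite <- Ev, t0. reflexivity. }
  (* The defect of the second family at (m, n). It satisfies the first family itself, so its
     vanishing on two adjacent columns spreads to all. *)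
  set (T := fun m n => v m (n + 1)%Z + 2 * q1 * v (m - 1)%Z (n + 2)%Z - q2 * v m
    (n - 1)%Z - th * IZR n * v m n).
  (* theta D_1 - D_1 F and theta D_2 - D_2 F commute *)
  assert (RT : forall m n, th * IZR m * T m n = T (m + 1)%Z n - q1 * T (m - 1)%Z
    (n + 2)%Z).
  { intros m n. unfold T.
    assert (H1 := R1 m (n + 1)%Z). assert (H2 := R1 (m - 1)%Z (n + 2)%Z).
    assert (H3 := R1 m (n - 1)%Z). assert (H4 := R1 m n).
    replace (m - 1 + 1)%Z with m in * by lia.
    replace (m + 1 - 1)%Z with m by lia.
    replace (n + 1 + 2)%Z with (n + 2 + 1)%Z in H1 by lia.
    replace (n - 1 + 2)%Z with (n + 1)%Z in H3 by lia.
    replace (n + 2 - 1)%Z with (n + 1)%Z by lia.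
    rewrite minus_IZR, RtoC_minus in H2. rewrite plus_IZR, RtoC_plus.
    replace (v (m + 1)%Z (n + 1)%Z) with (th * IZR m * v m (n + 1)%Z + q1 * v (m
      - 1)%Z (n + 2 + 1)%Z) by (rewrite H1; ring).
    replace (v (m + 1)%Z (n - 1)%Z) with (th * IZR m * v m (n - 1)%Z + q1 * v (m
      - 1)%Z (n + 1)%Z) by (rewrite H3; ring).
    replace (v (m + 1)%Z n) with (th * IZR m * v m n + q1 * v (m - 1)%Z (n +
      2)%Z) by (rewrite H4; ring).
    replace (v m (n + 2)%Z) with (th * (IZR m - 1) * v (m - 1)%Z (n + 2)%Z + q1
      * v (m - 1 - 1)%Z (n + 2 + 2)%Z) by (rewrite H2; ring).
    ring. }
  assert (T0 : forall n, T 0%Z n = 0).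
  { intro n. unfold T. change (0 - 1)%Z with (-1)%Z. rewrite !V0, V1, Eb, Ea.
    unfold fa. field. exact D'. }
  assert (T1 : forall n, T (-1)%Z n = 0).
  { intro n. unfold T. rewrite !V1.
    assert (H := R1 (-1)%Z n). change (-1 + 1)%Z with 0%Z in H.
    rewrite V0, V1 in H.
    assert (H' := Eb (n - 1)%Z).
    replace (n - 1 + 2)%Z with (n + 1)%Z in H' by lia.
    replace (n - 1 + 1)%Z with n in H' by lia. rewrite H'.
    replace (2 * q1 * v (-1 - 1)%Z (n + 2)%Z) with (2 * (q1 * v (-1 - 1)%Z (n +
      2)%Z)) by ring.
    replace (q1 * v (-1 - 1)%Z (n + 2)%Z) with (a n - th * IZR (-1) * b n) by
      (rewrite H; ring).
    rewrite !minus_IZR, !RtoC_minus. simpl. ring. }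
  assert (TZ : forall m, (forall n, T m n = 0) /\ (forall n,
    T (m - 1)%Z n = 0)).
  { apply Z_bi_ind; [split; assumption | |].
    - intros m [H1 H2].
      split; [| replace (m + 1 - 1)%Z with m by lia; exact H1].
      intro n. assert (H := RT m n). rewrite H1, H2 in H.
      transitivity (T (m + 1)%Z n - q1 * 0); [ring |]. rewrite <- H. ring.
    - intros m [H1 H2]. split; [exact H2 |]. intro n.
      assert (H := RT (m - 1)%Z (n - 2)%Z).
      replace (m - 1 + 1)%Z with m in H by lia.
      replace (n - 2 + 2)%Z with n in H by lia. rewrite H1, H2 in H.
      transitivity (- (0 - q1 * T (m - 1 - 1)%Z n) / q1); [field; exact N1 |].
      rewrite <- H. field. exact N1. }
  exists v. split; [split; [exact R1 |] |].
  - intros m n. assert (H := proj1 (TZ m) n). unfold T in H. fold q1 q2.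
    transitivity (v m (n + 1)%Z + 2 * q1 * v (m - 1)%Z (n + 2)%Z - q2 * v m (n -
      1)%Z -
     (v m (n + 1)%Z + 2 * q1 * v (m - 1)%Z (n + 2)%Z - q2 * v m (n - 1)%Z - th *
       IZR n * v m n)); [ring |].
    rewrite H. ring.
  - rewrite !V0, !V1, A0, A1, B1. repeat split.
    assert (H := Eb 0%Z). simpl in H. rewrite H. assert (H' := Ea 0%Z).
    simpl in H'. rewrite H'.
    unfold fa. rewrite A0, A1, B1, B0. simpl. field. auto.
Qed.

(** * The basis and the matrices of the connection *)

Definition omega_e (k : nat) (q u : C * C) : C :=
  match k with
  | 0%nat => e 0 0 u
  | 1%nat => snd q * e 0 (-1) u
  | 2%nat => fst q * snd q * e (-1) 1 u
  | _ => fst q * e (-1) 2 u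
  end.

Lemma grad_F_q (q u : C * C) :
  grad (fun p => F p u) q (snd u ^ 2 / fst u) (/ snd u).
Proof.
  assert (G := grad_plus _ _ _ _ _ _ _ (grad_plus _ _ _ _ _ _ _ (grad_const (fst
    u + snd u) q)
     (grad_mult _ _ _ _ _ _ _ (grad_fst q) (grad_const (snd u ^ 2 / fst u) q)))
    (grad_mult _ _ _ _ _ _ _ (grad_snd q) (grad_const (/ snd u) q))).
  eapply grad_eq; [exact G | |]; simpl; ring.
Qed.

Lemma nabla_q_eq (i : coord) (eta : twoform) (f : C * C -> C) q th u :
  M q -> (forall p, M p -> eta (p, th, u) = f p) -> hol_at f q ->
  nabla_q i eta (q, th, u) = pderiv i f q -
    / th * (match i with c1 => snd u ^ 2 / fst u | c2 => / snd u end * f q).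
Proof.
  intros Hq E Hf. unfold nabla_q. rewrite E by exact Hq.
  destruct (grad_pderiv _ _ _ _ (grad_F_q q u)) as [E1 E2].
  rewrite (pderiv_ext f); [| | exact Hf].
  - destruct i; rewrite ?E1, ?E2; reflexivity.
  - eapply filter_imp; [| exact (open_M q Hq)]. intros p Hp. symmetry. auto.
Qed.

Lemma pderiv_const c i q : pderiv i (fun _ => c) q = 0.
Proof. destruct (grad_pderiv _ _ _ _ (grad_const c q)). destruct i; assumption.
Qed.

(** theta q_i nabla_(q_i) multiplies a form by -q_i dF/dq_i when the coefficient does not depend on
    q_i. This holds at every step, including the second one for omega_2, whose input involves q1 but
    not q2. *)
Lemma omega_eq k q (th : C) u : M q -> th <> 0 -> U u -> omega k (q, th,
  u) = omega_e k q u.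
Proof.
  intros Hq Hth Hu. revert q Hq.
  assert (H0 : forall i p, M p ->
    nabla_q i omega0 (p, th, u) = - / th * (match i with c1 => snd u ^ 2 / fst u
      | c2 => / snd u end * (/ fst u * / snd u))).
  { intros i p Hp. rewrite (nabla_q_eq i omega0 (fun _ => / fst u * / snd u)).
    - rewrite pderiv_const. ring.
    - exact Hp.
    - reflexivity.
    - apply hol_const. }
  destruct Hu as [N1 N2].
  destruct k as [|[|[|k]]]; intros q Hq; unfold omega, omega_e, e, mono;
    cbv beta iota; cbn [Z.sub Z.add Z.opp Z.pos_sub Pos.add Pos.succ
    Pos.pred_double].
  - simpl. field. auto.
  - unfold th_q_nabla. rewrite H0 by exact Hq. simpl. field. auto.
  - unfold th_q_nabla at 1.
    rewrite (nabla_q_eq c2 _ (fun p => fst p * (- (snd u ^ 2 / fst u * (/ fst u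
      * / snd u))))).
    + replace (pderiv c2 (fun p => fst p * (- (snd u ^ 2 / fst u * (/ fst u * /
        snd u)))) q) with (RtoC 0).
      * simpl. field. auto.
      * destruct (grad_pderiv _ _ _ _ (grad_mult _ _ _ _ _ _ _ (grad_fst q)
          (grad_const (- (snd u ^ 2 / fst u * (/ fst u * / snd u))) q))) as [_
          ->]. ring.
    + exact Hq.
    + intros p Hp. unfold th_q_nabla. rewrite H0 by exact Hp. simpl. field.
      auto.
    + apply (hol_mult fst); [apply hol_fst | apply hol_const].
  - unfold th_q_nabla. rewrite H0 by exact Hq. simpl. field. auto.
Qed.

Lemma lincomb_eq c q (th : C) u : M q -> th <> 0 -> U u ->
  lincomb c (q, th, u) = c 0%nat (q, th) * omega_e 0 q u + c 1%nat (q,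
    th) * omega_e 1 q u
    + c 2%nat (q, th) * omega_e 2 q u + c 3%nat (q, th) * omega_e 3 q u.
Proof.
  intros Hq Hth Hu. unfold lincomb. rewrite sum_n_3, !omega_eq by assumption.
  reflexivity.
Qed.

(** Up to units, the omega_k are e(0,0), e(0,-1), e(-1,1), e(-1,2). The functional with value 1 on
    the k-th of these and 0 on the others kills null forms and isolates d_k. *)
Lemma omega_free q (th : C) (eta : twoform) (d : nat -> C) : M q -> th <> 0 ->
  null eta ->
  (forall u, U u -> eta (q, th, u) = d 0%nat * omega_e 0 q u + d 1%nat * omega_e
    1 q u
     + d 2%nat * omega_e 2 q u + d 3%nat * omega_e 3 q u) ->
  forall k, (k <= 3)%nat -> d k = 0.
Proof.
  intros Hq Hth Hn E k Hk.
  set (l := [(d 0%nat, (-1, -1)%Z); (d 1%nat * snd q, (-1, -2)%Z);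
    (d 2%nat * (fst q * snd q), (-2, 0)%Z);
      (d 3%nat * fst q, (-2, 1)%Z)] : laurent).
  assert (El : forall u, U u -> eta (q, th, u) = eval l u).
  { intros u Hu. rewrite E by exact Hu. unfold eval, l, omega_e, e. simpl. ring.
    }
  set (x := fun j => if Nat.eqb j k then RtoC 1 else 0).
  destruct (period_weight_exists q th (x 0%nat) (x 1%nat) (x 2%nat) (x 3%nat)
    Hq)
    as (v & Hv & V0 & V1 & V2 & V3).
  assert (H := null_weight eta q th l v Hn Hq Hth El Hv).
  unfold l in H. simpl in H. rewrite V0, V1, V2, V3 in H. unfold x in H.
  destruct Hq as (N1 & N2 & _).
  destruct k as [|[|[|[|k]]]]; [| | | | lia]; simpl in H.
  - rewrite <- H. ring.
  - transitivity (d 1%nat * snd q / snd q); [field; exact N2 |].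
    transitivity (0 / snd q); [| field; exact N2]. f_equal. rewrite <- H. ring.
  - transitivity (d 2%nat * (fst q * snd q) / (fst q * snd q)); [field; auto |].
    transitivity (0 / (fst q * snd q)); [| field; auto]. f_equal. rewrite <- H.
    ring.
  - transitivity (d 3%nat * fst q / fst q); [field; exact N1 |].
    transitivity (0 / fst q); [| field; exact N1]. f_equal. rewrite <- H. ring.
Qed.

(** * Generation of the Brieskorn lattice *)

Definition spanned (eta : twoform) : Prop :=
  exists c, (forall k, regMth (c k)) /\ eqG0 eta (lincomb c).

Lemma spanned_ext eta' d eta : spanned eta' -> null d ->
  (forall x, MthU x -> eta x = eta' x + d x) -> spanned eta.
Proof.
  intros (c & Hc & H) Hd E. exists c. split; [exact Hc |].
  apply (null_ext _ _ (null_add _ _ H Hd)). intros x Hx. rewrite E by exact Hx.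
  ring.
Qed.

Lemma spanned_add eta eta' : spanned eta -> spanned eta' -> spanned (fun x =>
  eta x + eta' x).
Proof.
  intros (c & Hc & H) (c' & Hc' & H').
  exists (fun k x => c k x + c' k x). split.
  - intro k. exact (reg_add _ _ _ _ (Hc k) (Hc' k)).
  - apply (null_ext _ _ (null_add _ _ H H')). intros [[q th] u] (Hq & Hth & Hu).
    rewrite !lincomb_eq by assumption. ring.
Qed.

Lemma spanned_scal a eta : regMth a -> spanned eta -> spanned (fun x => a (fst
  x) * eta x).
Proof.
  intros Ha (c & Hc & H).
  exists (fun k x => a x * c k x). split.
  - intro k. exact (reg_mul _ _ _ _ Ha (Hc k)).
  - apply (null_ext _ _ (null_scal _ _ Ha H)).
    intros [[q th] u] (Hq & Hth & Hu).
    rewrite !lincomb_eq by assumption. simpl. ring.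
Qed.

Lemma null_zero : null (fun _ => 0).
Proof.
  apply (null_ext _ _ (null_scal (fun _ => 0) _ (reg_const _ _ 0) (null_rel c1 0
    0))).
  intros; ring.
Qed.

Lemma spanned_omega j : (j <= 3)%nat -> spanned (fun '(q, th,
  u) => omega_e j q u).
Proof.
  intro Hj. exists (fun k _ => if Nat.eqb k j then 1 else 0). split.
  - intro k. destruct (Nat.eqb k j); apply reg_const.
  - apply (null_ext _ _ null_zero). intros [[q th] u] (Hq & Hth & Hu).
    rewrite lincomb_eq by assumption.
    destruct j as [|[|[|[|j]]]]; [| | | | lia]; simpl; ring.
Qed.

Definition ef (m n : Z) : twoform := fun x => e m n (snd x).

Lemma spanned_base : spanned (ef 0 0) /\ spanned (ef 0 (-1)) /\ spanned (ef (-1)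
  1) /\ spanned (ef (-1) 2).
Proof.
  repeat split.
  - apply (spanned_ext _ _ _ (spanned_omega 0 ltac:(lia)) null_zero).
    intros [[q th] u] _. unfold ef, omega_e. simpl. ring.
  - assert (R : regMth (fun x => / snd (fst x))) by reg.
    apply (spanned_ext _ _ _ (spanned_scal _ _ R (spanned_omega 1 ltac:(lia)))
      null_zero).
    intros [[q th] u] ((N1 & N2 & _) & _). unfold ef, omega_e. simpl. field.
    exact N2.
  - assert (R : regMth (fun x => / fst (fst x) * / snd (fst x))) by reg.
    apply (spanned_ext _ _ _ (spanned_scal _ _ R (spanned_omega 2 ltac:(lia)))
      null_zero).
    intros [[q th] u] ((N1 & N2 & _) & _). unfold ef, omega_e. simpl. field.
    auto.
  - assert (R : regMth (fun x => / fst (fst x))) by reg.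
    apply (spanned_ext _ _ _ (spanned_scal _ _ R (spanned_omega 3 ltac:(lia)))
      null_zero).
    intros [[q th] u] ((N1 & N2 & _) & _). unfold ef, omega_e. simpl. field.
    exact N1.
Qed.

(* rel c2 (-1) n + 2 rel c1 (-1) n, in which the column m = -2 cancels. *)
Definition relB (n : Z) : twoform := fun '(q, th, u) =>
  th * (IZR n - 2) * e (-1) n u - e (-1) (n + 1) u - 2 * e 0 n u + snd q * e
    (-1) (n - 1) u.

Lemma null_relB n : null (relB n).
Proof.
  apply (null_ext _ _ (null_add _ _ (null_rel c2 (-1) n) (null_scal _ _
    (reg_const _ _ 2) (null_rel c1 (-1) n)))).
  intros [[q th] u] _. unfold relB, rel. simpl. ring.
Qed.

(** The window (a_n, a_(n-1), b_(n+1), b_n) of the recurrence in [period_weight_exists], now for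
    classes instead of values of a functional. *)
Definition state (n : Z) : Prop :=
  spanned (ef 0 n) /\ spanned (ef 0 (n - 1)) /\ spanned (ef (-1) (n + 1)) /\
    spanned (ef (-1) n).

Lemma regMth_const (c : C) : regMth (fun _ => c).
Proof. apply reg_const. Qed.

(** Eliminating e(-1, n+2) between [rel c2 0 n] and [relB (n + 1)] leaves e(0, n+1) with the
    invertible coefficient 4 q1 - 1; [relB (n + 1)] then gives e(-1, n+2). *)
Lemma state_succ n : state n -> state (n + 1).
Proof.
  intros (A & A' & B & B'). unfold state.
  assert (A1 : spanned (ef 0 (n + 1))).
  { assert (Ra : regMth (fun x => snd x * IZR n * (- / (4 * fst (fst x) - 1))))
      by reg.
    assert (Ra' : regMth (fun x => snd (fst x) * (- / (4 * fst (fst x) - 1))))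
      by reg.
    assert (Rb : regMth (fun x => - 2 * fst (fst x) * (snd x * (IZR n - 1)) * (-
      / (4 * fst (fst x) - 1)))) by reg.
    assert (Rb' : regMth (fun x => - 2 * fst (fst x) * snd (fst x) * (- / (4 *
      fst (fst x) - 1)))) by reg.
    assert (R1 : regMth (fun x => / (4 * fst (fst x) - 1))) by reg.
    assert (R2 : regMth (fun x => - 2 * fst (fst x) * / (4 * fst (fst x) - 1)))
      by reg.
    apply (spanned_ext _ _ _
      (spanned_add _ _ (spanned_add _ _ (spanned_scal _ _ Ra A) (spanned_scal _
        _ Ra' A'))
        (spanned_add _ _ (spanned_scal _ _ Rb B) (spanned_scal _ _ Rb' B')))
      (null_add _ _ (null_scal _ _ R1 (null_rel c2 0 n)) (null_scal _ _ R2
        (null_relB (n + 1))))).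
    intros [[q th] u] (Hq & _). assert (D := M_disc q Hq). unfold ef, rel, relB.
    simpl fst. simpl snd.
    rewrite plus_IZR, RtoC_plus. change (0 - 1)%Z with (-1)%Z.
    replace (n + 1 + 1)%Z with (n + 2)%Z by lia.
    replace (n + 1 - 1)%Z with n by lia.
    field. exact D. }
  split; [exact A1 |]. split; [replace (n + 1 - 1)%Z with n by lia; exact A |].
  split; [| exact B].
  assert (R1 : regMth (fun x => snd x * (IZR n - 1))) by reg.
  assert (R2 : regMth (fun x => snd (fst x))) by reg.
  apply (spanned_ext _ _ _
    (spanned_add _ _ (spanned_scal _ _ R1 B) (spanned_add _ _ (spanned_scal _ _
      R2 B')
       (spanned_scal _ _ (regMth_const (- 2)) A1)))
    (null_scal _ _ (regMth_const (- (1))) (null_relB (n + 1)))).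
  intros [[q th] u] (Hq & _). unfold ef, rel, relB. simpl fst. simpl snd.
  rewrite plus_IZR, RtoC_plus. replace (n + 1 - 1)%Z with n by lia. ring.
Qed.

(** The lowest terms of [rel c2 0 (n - 1)] and [relB n] are e(0, n-2) and e(-1, n-1), both with the
    invertible coefficient q2. *)
Lemma state_pred n : state n -> state (n - 1).
Proof.
  intros (A & A' & B & B'). unfold state.
  replace (n - 1 + 1)%Z with n by lia.
  split; [exact A' |]. split; [| split; [exact B' |]].
  - assert (R1 : regMth (fun x => / snd (fst x))) by reg.
    assert (R2 : regMth (fun x => 2 * fst (fst x) * / snd (fst x))) by reg.
    assert (R3 : regMth (fun x => - (snd x * (IZR n - 1)) * / snd (fst x))) by
      reg.
    apply (spanned_ext _ _ _
      (spanned_add _ _ (spanned_scal _ _ R1 A) (spanned_add _ _ (spanned_scal _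
        _ R2 B)
       (spanned_scal _ _ R3 A')))
      (null_scal _ _ R1 (null_rel c2 0 (n - 1)))).
    intros [[q th] u] ((_ & N2 & _) & _). unfold ef, rel, relB. simpl fst.
    simpl snd.
    rewrite minus_IZR, RtoC_minus. replace (n - 1 + 1)%Z with n by lia.
    replace (n - 1 + 2)%Z with (n + 1)%Z by lia. change (0 - 1)%Z with (-1)%Z.
    field. exact N2.
  - assert (R1 : regMth (fun x => / snd (fst x))) by reg.
    assert (R2 : regMth (fun x => 2 * / snd (fst x))) by reg.
    assert (R3 : regMth (fun x => - (snd x * (IZR n - 2)) * / snd (fst x))) by
      reg.
    apply (spanned_ext _ _ _
      (spanned_add _ _ (spanned_scal _ _ R1 B) (spanned_add _ _ (spanned_scal _
        _ R2 A)
       (spanned_scal _ _ R3 B')))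
      (null_scal _ _ R1 (null_relB n))).
    intros [[q th] u] ((_ & N2 & _) & _). unfold ef, rel, relB. simpl fst.
    simpl snd.
    field. exact N2.
Qed.

(** The basis contains e(-1,2) where the window has e(-1,0); [relB 1], with e(0,1) removed by
    [rel c2 0 0], exchanges them. *)
Lemma state_0 : state 0.
Proof.
  destruct spanned_base as (A & A' & B & B2).
  unfold state. simpl. repeat (split; [assumption |]).
  assert (R1 : regMth (fun x => (1 - 4 * fst (fst x)) * / snd (fst x))) by reg.
  assert (R2 : regMth (fun x => snd x * / snd (fst x))) by reg.
  assert (R3 : regMth (fun x => / snd (fst x))) by reg.
  assert (R4 : regMth (fun x => - 2 * / snd (fst x))) by reg.
  apply (spanned_ext _ _ _
      (spanned_add _ _ (spanned_scal _ _ R1 B2) (spanned_add _ _ (spanned_scal _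
        _ R2 B)
       (spanned_scal _ _ (regMth_const 2) A')))
      (null_add _ _ (null_scal _ _ R3 (null_relB 1)) (null_scal _ _ R4 (null_rel
        c2 0 0)))).
  intros [[q th] u] ((_ & N2 & _) & _). unfold ef, rel, relB. simpl. field.
  exact N2.
Qed.

Lemma spanned_e m n : spanned (ef m n).
Proof.
  assert (S : forall n, state n) by (apply Z_bi_ind;
    [exact state_0 | exact state_succ | exact state_pred]).
  assert (H : forall m, (forall n, spanned (ef m n)) /\ (forall n,
    spanned (ef (m - 1) n))).
  { clear m n. apply Z_bi_ind.
    - split; intro n; apply S.
    - intros m [H1 H2].
      split; [| replace (m + 1 - 1)%Z with m by lia; exact H1].
      intro n. assert (R1 : regMth (fun x => fst (fst x))) by reg.
      assert (R2 : regMth (fun x => snd x * IZR m)) by reg.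
      apply (spanned_ext _ _ _
        (spanned_add _ _ (spanned_scal _ _ R1 (H2 (n + 2)%Z)) (spanned_scal _ _
          R2 (H1 n)))
        (null_scal _ _ (regMth_const (- (1))) (null_rel c1 m n))).
      intros [[q th] u] _. unfold ef, rel. simpl fst. simpl snd. ring.
    - intros m [H1 H2]. split; [exact H2 |].
      intro n. assert (R1 : regMth (fun x => / fst (fst x))) by reg.
      assert (R2 : regMth (fun x => - (snd x * (IZR m - 1)) * / fst (fst x))) by
        reg.
      apply (spanned_ext _ _ _
        (spanned_add _ _ (spanned_scal _ _ R1 (H1 (n - 2)%Z)) (spanned_scal _ _
          R2 (H2 (n - 2)%Z)))
        (null_scal _ _ R1 (null_rel c1 (m - 1) (n - 2)))).
      intros [[q th] u] ((N1 & _) & _). unfold ef, rel. simpl fst. simpl snd.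
      rewrite minus_IZR, RtoC_minus.
      replace (m - 1 + 1)%Z with m by lia. replace (n - 2 + 2)%Z with n by lia.
      field. exact N1. }
  apply H.
Qed.

Lemma spanned_mono m n : spanned (fun x => mono m n (snd x)).
Proof.
  apply (spanned_ext _ _ _ (spanned_e (m + 1) (n + 1)) null_zero).
  intros x _. rewrite mono_e. unfold ef. ring.
Qed.

(** Being spanned alone is too weak for the product case of an induction on [regular]; being spanned
    after multiplication by every monomial is preserved by each regular factor. *)
Definition stable (g : twoform) : Prop :=
  forall m n, spanned (fun x => g x * mono m n (snd x)).

Lemma stable_mul f g : regMthU f -> stable g -> stable (fun x => f x * g x).
Proof.
  assert (He : forall f g, spanned f -> (forall x,
    MthU x -> g x = f x) -> spanned g).
  { intros f0 g0 Sf E. apply (spanned_ext _ _ _ Sf null_zero). intros x Hx.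
    rewrite E by exact Hx. ring. }
  intro H. revert g.
  induction H as [a | f Hf | f f' _ IH1 _ IH2 | f f' _ IH1 _ IH2 | f f' _ IH E];
    intros g Hg m n.
  - apply (He _ _ (spanned_scal _ _ (regMth_const a) (Hg m n))). intros; ring.
  - apply in_app_or in Hf. destruct Hf as [Hf | Hf].
    + assert (Hs : exists a b, forall x, MthU x -> f x = mono a b (snd x)).
      { simpl in Hf.
        repeat destruct Hf as [Hf | Hf]; try contradiction; subst f.
        - exists 1%Z, 0%Z. intros x _. unfold mono. simpl. ring.
        - exists 0%Z, 1%Z. intros x _. unfold mono. simpl. ring.
        - exists (-1)%Z, 0%Z. intros [[q th] u] (_ & _ & N & _). unfold mono.
          simpl. field. exact N.
        - exists 0%Z, (-1)%Z. intros [[q th] u] (_ & _ & _ & N). unfold mono.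
          simpl. field. exact N. }
      destruct Hs as (a & b & Hs).
      apply (He _ _ (Hg (a + m)%Z (b + n)%Z)). intros x Hx.
      rewrite Hs by exact Hx.
      destruct x as [[q th] u]. rewrite mono_mul by apply Hx. ring.
    + apply in_map_iff in Hf. destruct Hf as (h & <- & Hh).
      apply (He _ _ (spanned_scal h _ (reg_gen _ _ h Hh) (Hg m n))).
      intros; ring.
  - apply (He _ _ (spanned_add _ _ (IH1 g Hg m n) (IH2 g Hg m n))).
    intros; ring.
  - apply (He _ _ (IH1 _ (IH2 g Hg) m n)). intros; ring.
  - apply (He _ _ (IH g Hg m n)). intros x Hx. rewrite E by exact Hx.
    reflexivity.
Qed.

Lemma spanned_regMthU eta : regMthU eta -> spanned eta.
Proof.
  intro H.
  assert (S1 : stable (fun _ => 1)).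
  { intros m n. apply (spanned_ext _ _ _ (spanned_mono m n) null_zero).
    intros; ring. }
  apply (spanned_ext _ _ _ (stable_mul eta _ H S1 0%Z 0%Z) null_zero).
  intros x _. unfold mono. simpl. ring.
Qed.

Lemma regMthU_omega_e k : regMthU (fun '(q, th, u) => omega_e k q u).
Proof.
  assert (R1 : regMthU (fun x => fst (fst (fst x)))) by exact (regMthU_of_regMth
    _ (regMth_of_regM _ regM_q1)).
  assert (R2 : regMthU (fun x => snd (fst (fst x)))) by exact (regMthU_of_regMth
    _ (regMth_of_regM _ regM_q2)).
  assert (Rm : forall m n, regMthU (fun x => e m n (snd x))) by (intros;
    apply regMthU_mono).
  destruct k as [|[|[|k]]].
  - apply (reg_ext _ _ _ _ (Rm 0%Z 0%Z)). intros [[q th] u] _. reflexivity.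
  - apply (reg_ext _ _ _ _ (reg_mul _ _ _ _ R2 (Rm 0%Z (-1)%Z))).
    intros [[q th] u] _. reflexivity.
  - apply (reg_ext _ _ _ _ (reg_mul _ _ _ _ (reg_mul _ _ _ _ R1 R2) (Rm (-1)%Z
      1%Z))). intros [[q th] u] _. reflexivity.
  - apply (reg_ext _ _ _ _ (reg_mul _ _ _ _ R1 (Rm (-1)%Z 2%Z))).
    intros [[q th] u] _. reflexivity.
Qed.

Lemma omega_basis_holds : omega_basis.
Proof.
  split; [| split].
  - intros k _. apply (reg_ext _ _ _ _ (regMthU_omega_e k)).
    intros [[q th] u] (Hq & Hth & Hu). apply omega_eq; assumption.
  - exact spanned_regMthU.
  - intros c _ H k Hk [q th] [Hq Hth].
    apply (omega_free q th _ (fun k => c k (q, th)) Hq Hth H); [| exact Hk].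
    intros u Hu. rewrite lincomb_eq by assumption. ring.
Qed.

(** * The matrices of nabla *)

Lemma nabla_q_omega i j q (th : C) u : (j <= 3)%nat -> M q -> th <> 0 -> U u ->
  nabla_q i (omega j) (q, th, u) =
  match i, j with
  | c1, 2%nat => snd q * e (-1) 1 u
  | c1, 3%nat => e (-1) 2 u
  | c2, 1%nat => e 0 (-1) u
  | c2, 2%nat => fst q * e (-1) 1 u
  | _, _ => 0
  end - / th * (match i with c1 => snd u ^ 2 / fst u | c2 => / snd u end *
    omega_e j q u).
Proof.
  intros Hj Hq Hth Hu.
  assert (G : grad (fun p => omega_e j p u) q
    match j with 2%nat => snd q * e (-1) 1 u | 3%nat => e (-1) 2 u | _ => 0 end
    match j with 1%nat => e 0 (-1) u | 2%nat => fst q * e (-1) 1 u | _ => 0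
      end).
  { destruct j as [|[|[|[|j]]]]; [| | | | lia]; unfold omega_e.
    - apply grad_const.
    - eapply grad_eq; [exact (grad_mult _ _ _ _ _ _ _ (grad_snd q) (grad_const _
        q)) | |]; cbv beta; ring.
    - eapply grad_eq; [exact (grad_mult _ _ _ _ _ _ _ (grad_mult _ _ _ _ _ _ _
        (grad_fst q) (grad_snd q)) (grad_const _ q)) | |]; cbv beta; ring.
    - eapply grad_eq; [exact (grad_mult _ _ _ _ _ _ _ (grad_fst q) (grad_const _
        q)) | |]; cbv beta; ring. }
  rewrite (nabla_q_eq i _ (fun p => omega_e j p u)).
  - f_equal. apply grad_pderiv in G. destruct G as [G1 G2].
    destruct i; rewrite ?G1, ?G2; destruct j as [|[|[|[|j]]]];
      reflexivity || lia.
  - exact Hq.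
  - intros p Hp. apply omega_eq; assumption.
  - do 2 eexists. exact G.
Qed.

Lemma nabla_th_omega j q (th : C) u : M q -> th <> 0 -> U u ->
  nabla_th (omega j) (q, th, u) = / th ^ 2 * (F q u * omega_e j q u).
Proof.
  intros Hq Hth Hu. unfold nabla_th. rewrite omega_eq by assumption.
  rewrite (cder_unique _ _ 0); [ring |].
  apply (cder_ext (fun _ => omega_e j q u)).
  - eapply filter_imp; [| exact (locally_C_neq0 th Hth)].
    intros t Ht. symmetry. apply omega_eq; assumption.
  - eapply cdiff_lin; [apply cdiff_const |]. intro h. cbv beta. ring.
Qed.

Ltac rels := unfold rel, relB, omega_e, e, mono, F; simpl; field; repeat split;
  assumption.

Lemma nabla_q_conn i j : (j <= 3)%nat ->
  null (fun '(q, th, u) => th * nabla_q i (omega j) (q, th, u) -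
    th * lincomb (fun k '(q, th) => res_F i k j q + Phi_F i k j q / th) (q, th,
      u)).
Proof.
  intro Hj.
  (* Four of the eight images are multiples of some omega_k on the nose; the others need relations.
     For omega_3 along q1, [rel c1 (-1) 2] leaves -e(0,2), which [rel c2 0 1] and [relB 2] determine
     after division by 4 q1 - 1. The remaining theta e(0,1) is rewritten by [rel c2 0 0] and gives
     the entries of [res_F]. *)
  cut (null (fun '(q, th, u) =>
    match i, j with
    | c1, 2%nat => snd q * (rel c2 0 0 (q, th, u) - rel c1 (-1) 1 (q, th, u))
    | c1, 3%nat => - rel c1 (-1) 2 (q, th, u)
        - / (4 * fst q - 1) * (rel c2 0 1 (q, th, u) - 2 * fst q * relB 2 (q,
            th, u) + th * rel c2 0 0 (q, th, u))
    | c2, 1%nat => - rel c2 0 (-1) (q, th, u)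
    | c2, 2%nat => fst q * (2 * rel c2 0 0 (q, th, u) - relB 1 (q, th, u))
    | _, _ => 0
    end)).
  { intro H. apply (null_ext _ _ H). intros [[q th] u] (Hq & Hth & Hu).
    rewrite nabla_q_omega, lincomb_eq by assumption.
    assert (D := M_disc q Hq). destruct Hq as (N1 & N2 & _).
    destruct Hu as [U1 U2].
    destruct i; destruct j as [|[|[|[|j]]]]; try lia; unfold res_F, Phi_F; rels.
    }
  assert (R1 : regMth (fun x => snd (fst x))) by reg.
  assert (R2 : regMth (fun x => - snd (fst x))) by reg.
  assert (R3 : regMth (fun x => - / (4 * fst (fst x) - 1))) by reg.
  assert (R4 : regMth (fun x => 2 * fst (fst x) * / (4 * fst (fst x) - 1))) by
    reg.
  assert (R5 : regMth (fun x => - snd x * / (4 * fst (fst x) - 1))) by reg.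
  assert (R6 : regMth (fun x => 2 * fst (fst x))) by reg.
  assert (R7 : regMth (fun x => - fst (fst x))) by reg.
  destruct i; destruct j as [|[|[|[|j]]]]; try (apply (null_ext _ _ null_zero);
    intros [[q th] u] _; cbv beta iota; exact (eq_refl (RtoC 0))); try lia.
  - apply (null_ext _ _ (null_add _ _ (null_scal _ _ R1 (null_rel c2 0 0))
      (null_scal _ _ R2 (null_rel c1 (-1) 1)))).
    intros [[q th] u] _. simpl fst. simpl snd. ring.
  - apply (null_ext _ _ (null_add _ _ (null_scal _ _ (regMth_const (- (1)))
      (null_rel c1 (-1) 2))
      (null_add _ _ (null_scal _ _ R3 (null_rel c2 0 1)) (null_add _ _
        (null_scal _ _ R4 (null_relB 2))
        (null_scal _ _ R5 (null_rel c2 0 0)))))).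
    intros [[q th] u] _. simpl fst. simpl snd. ring.
  - apply (null_ext _ _ (null_scal _ _ (regMth_const (- (1))) (null_rel c2 0
      (-1)))).
    intros [[q th] u] _. simpl fst. simpl snd. ring.
  - apply (null_ext _ _ (null_add _ _ (null_scal _ _ R6 (null_rel c2 0 0))
      (null_scal _ _ R7 (null_relB 1)))).
    intros [[q th] u] _. simpl fst. simpl snd. ring.
Qed.

Lemma nabla_th_conn j : (j <= 3)%nat ->
  null (fun '(q, th, u) => th ^ 2 * nabla_th (omega j) (q, th, u) -
    th ^ 2 * lincomb (fun k '(q, th) => (V0_F k j q / th + Vinf_F k j q) / th)
      (q, th, u)).
Proof.
  intro Hj.
  assert (R1 : regMth (fun x => snd (fst x))) by reg.
  assert (R2 : regMth (fun x => - snd (fst x))) by reg.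
  assert (R3 : regMth (fun x => fst (fst x) * snd (fst x))) by reg.
  assert (R4 : regMth (fun x => - (fst (fst x) * snd (fst x)))) by reg.
  assert (R5 : regMth (fun x => 2 * (fst (fst x) * snd (fst x)))) by reg.
  assert (R6 : regMth (fun x => - 4 * (fst (fst x) * snd (fst x)))) by reg.
  assert (R7 : regMth (fun x => - fst (fst x))) by reg.
  (* Euler's identity F = D_1 F + D_2 F + 2 q2/u2 brings in [rel c1 m n + rel c2 m n] with a minus
     sign and leaves 2 q2 e(m, n-1). The latter is treated by the relations used for the derivative
     along q2, multiplied by -2 q2. *)
  cut (null (fun '(q, th, u) =>
    match j with
    | 0%nat => - rel c1 0 0 (q, th, u) - rel c2 0 0 (q, th, u)
    | 1%nat => snd q * (rel c2 0 (-1) (q, th, u) - rel c1 0 (-1) (q, th, u))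
    | 2%nat => fst q * snd q * (2 * relB 1 (q, th, u) - 4 * rel c2 0 0 (q, th,
      u)
        - rel c1 (-1) 1 (q, th, u) - rel c2 (-1) 1 (q, th, u))
    | _ => - fst q * (rel c1 (-1) 2 (q, th, u) + rel c2 (-1) 2 (q, th, u))
    end)).
  { intro H. apply (null_ext _ _ H). intros [[q th] u] (Hq & Hth & Hu).
    rewrite nabla_th_omega, lincomb_eq by assumption.
    assert (D := M_disc q Hq). destruct Hq as (N1 & N2 & _).
    destruct Hu as [U1 U2].
    destruct j as [|[|[|[|j]]]]; try lia; unfold V0_F, Vinf_F; rels. }
  destruct j as [|[|[|[|j]]]]; try lia.
  - apply (null_ext _ _ (null_add _ _ (null_scal _ _ (regMth_const (- (1)))
      (null_rel c1 0 0))
      (null_scal _ _ (regMth_const (- (1))) (null_rel c2 0 0)))).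
    intros [[q th] u] _. simpl fst. simpl snd. ring.
  - apply (null_ext _ _ (null_add _ _ (null_scal _ _ R1 (null_rel c2 0 (-1)))
      (null_scal _ _ R2 (null_rel c1 0 (-1))))).
    intros [[q th] u] _. simpl fst. simpl snd. ring.
  - apply (null_ext _ _ (null_add _ _ (null_add _ _ (null_scal _ _ R5 (null_relB
      1)) (null_scal _ _ R6 (null_rel c2 0 0)))
       (null_add _ _ (null_scal _ _ R4 (null_rel c1 (-1) 1)) (null_scal _ _ R4
         (null_rel c2 (-1) 1))))).
    intros [[q th] u] _. simpl fst. simpl snd. ring.
  - apply (null_ext _ _ (null_add _ _ (null_scal _ _ R7 (null_rel c1 (-1) 2))
      (null_scal _ _ R7 (null_rel c2 (-1) 2)))).
    intros [[q th] u] _. simpl fst. simpl snd. ring.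
Qed.

Lemma is_conn_data_F : is_conn_data conn_F.
Proof.
  split; [exact omega_basis_holds |]. split; [| split].
  - intros i k j. simpl.
    assert (R1 : regM (fun q => / (4 * fst q - 1))) by reg.
    assert (R2 : regM (fun q => - 2 * / (4 * fst q - 1))) by reg.
    repeat split.
    + destruct i, k as [|[|[|[|k]]]], j as [|[|[|[|j]]]]; unfold res_F; reg.
    + destruct i, k as [|[|[|[|k]]]], j as [|[|[|[|j]]]]; unfold Phi_F; reg.
    + destruct k as [|[|[|[|k]]]], j as [|[|[|[|j]]]]; unfold V0_F; reg.
    + destruct k as [|[|[|[|k]]]], j as [|[|[|[|j]]]]; unfold Vinf_F; reg.
  - intros i j Hj. exists 1%nat. apply (null_ext _ _ (nabla_q_conn i j Hj)).
    intros [[q th] u] _. rewrite Cpow_1_r. reflexivity.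
  - intros j Hj. exists 2%nat. apply (null_ext _ _ (nabla_th_conn j Hj)).
    intros [[q th] u] _. reflexivity.
Qed.

(** Subtracting the two expansions of theta^(n+1) nabla omega_j gives a null combination of the
    omega_k, so freeness at (q, theta) makes res + Phi/theta the same for both. The values theta = 1
    and theta = 2 then determine [Phi] and [res] separately. *)
Lemma is_conn_data_agrees b : is_conn_data b -> agrees_F b.
Proof.
  intros (_ & _ & Hb & _) i k j q Hk Hj Hq.
  assert (H : forall th : C, th <> 0 ->
    res b i k j q + Phi b i k j q / th = res_F i k j q + Phi_F i k j q / th).
  { intros th Hth. destruct (Hb i j Hj) as [n Hn].
    assert (Rn : regMth (fun x => - snd x)) by reg.
    assert (Rn' : regMth (fun x => snd x ^ n)) by reg.
    assert (N := null_add _ _ (null_scal _ _ Rn Hn) (null_scal _ _ Rn'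
      (nabla_q_conn i j Hj))).
    assert (Z := omega_free q th _ (fun k => th ^ n * th * ((res b i k j q + Phi
      b i k j q / th) -
      (res_F i k j q + Phi_F i k j q / th))) Hq Hth N).
    assert (T : th ^ n <> 0) by (apply Cpow_nz; exact Hth).
    replace (res b i k j q + Phi b i k j q / th) with
      (th ^ n * th * ((res b i k j q + Phi b i k j q / th) - (res_F i k j q +
        Phi_F i k j q / th))
        / (th ^ n * th) + (res_F i k j q + Phi_F i k j q / th)) by (field;
          auto).
    cbv beta in Z. rewrite Z; [field; auto | | exact Hk].
    intros u Hu. simpl fst. simpl snd. rewrite !lincomb_eq by assumption. ring.
    }
  assert (T := two_neq0).
  assert (H1 := H 1 C1_neq0). assert (H2 := H 2 T).
  assert (E : Phi b i k j q = Phi_F i k j q).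
  { transitivity (2 * ((res b i k j q + Phi b i k j q / 1) - (res b i k j q +
      Phi b i k j q / 2))); [field; auto |].
    rewrite H1, H2. field. }
  split; [| exact E].
  transitivity ((res b i k j q + Phi b i k j q / 1) - Phi b i k j q); [field |].
  rewrite H1, E. field.
Qed.

Theorem theorem11p3p8 :
  (exists (b : conn_data) (G : christoffel),
     is_conn_data b /\ is_nabla_omega0 b G) /\
  (forall q : C * C, M q ->
     exists (W : C * C -> Prop) (s : C * C -> C) (phi : coord -> C * C -> C),
       open_in_M W /\ W q /\ sqrt_branch W s /\ phi_branch W phi) /\
  (forall (b : conn_data) (G : christoffel),
     is_conn_data b -> is_nabla_omega0 b G ->
     (forall (W : C * C -> Prop) (s : C * C -> C),
        open_in_M W -> sqrt_branch W s -> flat G W (xi1 s)) /\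
     flat G M xi2 /\
     (forall (W : C * C -> Prop) (phi : coord -> C * C -> C),
        open_in_M W -> phi_branch W phi ->
        (exists Y : coord -> vfield, dual_frame W phi Y) /\
        (forall Y : coord -> vfield, dual_frame W phi Y ->
           forall i : coord, flat G W (Y i)))).
Proof.
  split; [| split].
  - exists conn_F, christoffel_F. split; [exact is_conn_data_F |].
    apply is_nabla_omega0_F, is_conn_data_agrees, is_conn_data_F.
  - exact branches_exist.
  - intros b G Hb HG. apply is_conn_data_agrees in Hb.
    split; [| split].
    + intros W s HW Hs. exact (flat_xi1 b G W s Hb HG HW Hs).
    + apply (flat_xi2 b); [exact Hb | exact HG |]. split; [exact open_M | auto].
    + intros W phi HW Hphi. split.
      * eexists. exact (dual_frame_exists W phi HW Hphi).
      * intros Y HY. exact (dual_frame_flat b G W phi Y Hb HG HW Hphi HY).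
Qed.
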